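(* Let $\ell_1,\ell_2\in\mathbb{N}\setminus\{1\}$ satisfy $\gcd(\ell_1,\ell_2)=1$, and let $$p(x,y):=q(x,y)\bigl(x^{\ell_1}y^{\ell_2}-1\bigr),\qquad q(x,y)\in\{x,y\}.$$ Then, for every $n\ge\ell_1+\ell_2+1$, the generator family $\{1,p,-p\}$ satisfies property $\left(S_{n,\,2(\ell_1+\ell_2)}\right)$.
   Context: Here $\mathbb{N}=\{1,2,\ldots\}$, $\mathbb{N}_0=\mathbb{N}\cup\{0\}$, $\mathcal{P}_m=\{f\in\mathbb{R}[x,y]:\deg f\le m\}$, and $\mathcal{Z}_p=\{(x,y)\in\mathbb{R}^2:p(x,y)=0\}$. A truncated (bivariate) sequence of degree $2n$ is a family of real numbers $\beta\equiv\beta^{(2n)}=\{\beta_{i,j}\}_{i,j\in\mathbb{N}_0,\,i+j\le 2n}$. Its Riesz functional is the linear map $L_\beta:\mathcal{P}_{2n}\to\mathbb{R}$ with $L_\beta(x^iy^j)=\beta_{i,j}$. Let $\mathcal{B}_m$ denote the set of monomials of degree at most $m$. The moment matrix $M(n)\equiv M(n;\beta)$ is the symmetric matrix indexed by $\mathcal{B}_n\times\mathcal{B}_n$ whose entry at monomials $(u,v)$ is $L_\beta(uv)$. For a polynomial $f$ of degree $\delta\le 2n$, the localizing matrix $M_f(n)\equiv M_f(n;\beta)$ is the symmetric matrix indexed by $\mathcal{B}_{n-\lceil\delta/2\rceil}\times\mathcal{B}_{n-\lceil\delta/2\rceil}$ whose entry at $(u,v)$ is $L_\beta(fuv)$. For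 $k\in\mathbb{N}_0$, a positive extension of $M(n)$ of order $n+k$ is a moment matrix $M(n+k)\succeq 0$ (of some truncated sequence of degree $2(n+k)$) whose principal submatrix indexed by $\mathcal{B}_n$ equals $M(n)$. Let $Q=\{q_0:=1,q_1,\ldots,q_m\}\subset\mathbb{R}[x,y]$ and $K_Q=\{z\in\mathbb{R}^2:q_i(z)\ge 0,\ i=0,\ldots,m\}$. A $K_Q$-representing measure for $\beta^{(2n)}$ is a positive Borel measure $\mu$ on $\mathbb{R}^2$ supported on $K_Q$ with $\beta_{i,j}=\int x^iy^j\,d\mu$ for all $i+j\le 2n$. The family $Q$ satisfies property $(S_{n,k})$ if, for every truncated sequence $\beta^{(2n)}$ of degree $2n$: $\beta^{(2n)}$ has a $K_Q$-representing measure if and only if $M(n)$ admits a positive extension $M(n+k)$ such that $M_{q_i}(n+k)\succeq 0$ for $i=1,\ldots,m$. For $Q=\{1,p,-p\}$ one has $K_Q=\mathcal{Z}_p$. *)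

(* Defs.v *)
From HB Require Import structures.
From mathcomp Require Import all_boot all_order all_algebra.
(* The notations of mpoly conflict with those of mathcomp-analysis. *)
From mathcomp Require Import -(notations) mpoly.
From mathcomp Require Import all_classical all_reals all_analysis.

Set Implicit Arguments.
Unset Strict Implicit.
Unset Printing Implicit Defensive.

Import Order.TTheory GRing.Theory Num.Theory.
Import numFieldNormedType.Exports.

Local Open Scope classical_set_scope.
Local Open Scope ring_scope.

Notation bipoly R := (mpoly 2 R).

Definition polyx (R : realType) : bipoly R := mpolyX R (mnm1 ord0).
Definition polyy (R : realType) : bipoly R := mpolyX R (mnm1 ord_max).

Definition pdeg (R : realType) (f : bipoly R) : nat := (mmeasure mdeg f).-1.

Definition peval (R : realType) (f : bipoly R) (z : R * R) : R :=
  meval (fun i : 'I_2 => if i == ord0 then z.1 else z.2) f.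

(* Monomials are represented by their exponents (u ord0, u ord_max). *)
Notation monomial d := (bmultinom 2 d.+1).

Definition nmon (d : nat) : nat := #|{: monomial d}|.

Definition mon_of (d : nat) (i : 'I_(nmon d)) : monomial d := enum_val i.

Definition polymon (R : realType) (d : nat) (i : 'I_(nmon d)) : bipoly R :=
  mpolyX R (mon_of i).

Fact widen_mon_subproof (d e : nat) (le_de : (d <= e)%N) (u : monomial d) :
  (mdeg u < e.+1)%N.
Proof. exact: leq_trans (bmdeg u) _. Qed.

Definition widen_mon (d e : nat) (le_de : (d <= e)%N) (u : monomial d) :
  monomial e := BMultinom (widen_mon_subproof le_de u).

Definition widen_idx (d e : nat) (le_de : (d <= e)%N) (i : 'I_(nmon d)) :
  'I_(nmon e) := enum_rank (widen_mon le_de (mon_of i)).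

Definition tseq (R : realType) (d : nat) : Type := monomial d -> R.

(* Total in f: monomials of f of degree > d are ignored, so this is meaningful
   only for f of degree at most d. *)
Definition riesz (R : realType) (d : nat) (beta : tseq R d) (f : bipoly R) : R :=
  \sum_(u : monomial d) mcoeff u f * beta u.

Definition moment_mx (R : realType) (n : nat) (beta : tseq R (2 * n)) :
    'M[R]_(nmon n) :=
  \matrix_(i, j) riesz beta (polymon R i * polymon R j).

(* Meaningful only when pdeg f <= 2 * n, in which case no degree subtraction is
   truncated and riesz is only applied to polynomials of degree at most 2 * n. *)
Definition localizing_mx (R : realType) (n : nat) (beta : tseq R (2 * n))
    (f : bipoly R) : 'M[R]_(nmon (n - uphalf (pdeg f))) :=
  \matrix_(i, j) riesz beta (f * polymon R i * polymon R j).

Definition psdmx (R : realType) (m : nat) (A : 'M[R]_m) : Prop :=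
  A^T = A /\ forall v : 'rV[R]_m, 0 <= (v *m A *m v^T) 0 0.

Definition positive_extension (R : realType) (n k : nat)
    (beta : tseq R (2 * n)) (gamma : tseq R (2 * (n + k))) : Prop :=
  psdmx (moment_mx gamma) /\
  mxsub (widen_idx (leq_addr k n)) (widen_idx (leq_addr k n)) (moment_mx gamma)
    = moment_mx beta.

Definition semialg_set (R : realType) (Q : seq (bipoly R)) : set (R * R) :=
  [set z | forall i, (i < size Q)%N -> 0 <= peval Q`_i z].

(* The product sigma-algebra on this type is the Borel sigma-algebra of R^2. *)
Notation plane R := (measurableTypeR R * measurableTypeR R)%type.

(* As semialg_set Q is closed, being supported on it means that its complement
   is null. *)
Definition representing_measure (R : realType) (Q : seq (bipoly R)) (d : nat)
    (beta : tseq R d) (mu : {measure set (plane R) -> \bar R}) : Prop :=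
  mu (~` semialg_set Q) = 0%E /\
  forall u : monomial d,
    let xy (z : plane R) : R := (z.1 : R) ^+ u ord0 * (z.2 : R) ^+ u ord_max in
    mu.-integrable [set: plane R] (EFin \o xy) /\
    (\int[mu]_z (xy z)%:E = (beta u)%:E)%E.

(* Q is the list [:: q_0; ...; q_m] with q_0 = 1: the localizing conditions
   concern the indices 1, ..., m only. *)
Definition property_S (R : realType) (Q : seq (bipoly R)) (n k : nat) : Prop :=
  forall beta : tseq R (2 * n),
    (exists mu : {measure set (plane R) -> \bar R},
       representing_measure Q beta mu)
    <->
    (exists gamma : tseq R (2 * (n + k)),
       positive_extension beta gamma /\
       forall i, (0 < i < size Q)%N -> psdmx (localizing_mx gamma Q`_i)).

(* Main.v *)
Require Import Defs.
From HB Require Import structures.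
From mathcomp Require Import all_boot all_order all_algebra.
From mathcomp Require Import -(notations) mpoly.
From mathcomp Require Import all_classical all_reals all_analysis.
From mathcomp Require Import measurable_realfun complex ring lra zify.

Set Implicit Arguments.
Unset Strict Implicit.
Unset Printing Implicit Defensive.

Import Order.TTheory GRing.Theory Num.Theory.
Import numFieldNormedType.Exports.

Local Open Scope ring_scope.

(** Let c = x^l1 y^l2 - 1 and s = l1 + l2; take q = x, the other case being its
    mirror image. The zero set of p = x c is the disjoint union of the line
    x = 0 and of the curve c = 0, and modulo p the polynomials 1 - x^l1 y^l2 and
    x^l1 y^l2 are complementary idempotents that cut out the two pieces. The
    line is parametrized by y, and, l1 and l2 being coprime, the curve is
    parametrized by the nonzero reals t through (t^l2, t^-l1), so that
    x^i y^j becomes t^(l2 i - l1 j). Both directions of the theorem therefore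
    reduce to truncated moment problems in one variable, on the real line and on
    the nonzero reals.

    The one-variable result is [truncated_hamburger]: a positive semidefinite
    functional on polynomials of degree at most 2D is a finite sum of weighted
    point evaluations as soon as every polynomial whose square it kills
    generates, within degree 2D, an ideal that it kills. Its nodes are the roots of an orthogonal
    polynomial P of degree d: if P had a nonreal or a repeated root it would be
    h (u^2 + v^2) with u nonzero, and the functional would be both zero and
    positive at P h. So P has d distinct real roots, and interpolation at them
    is exact up to degree 2d - 1 ([gauss_quadrature]). When the functional is
    definite, P has degree D + 1 and the free moment of degree 2D + 1 serves to
    keep 0 from being a node ([definite_quadrature]); otherwise P is a
    polynomial of least degree whose square is killed.

    From an extension to a measure: the vanishing of the localizing matrices of
    p and -p makes the extended functional vanish on the multiples of p. Its
    products with the two idempotents, the extra order 2 s paying for their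
    degrees, are positive functionals on the line and on the curve. On the
    curve the moment of t^m may be read off any monomial x^i y^j with
    l2 i - l1 j = m ([curve_invariant]), and every exponent of the window that
    is needed occurs in low degree ([exponent_rep]). Knowing each functional a
    little beyond degree 2n gives the ideal condition by the Cauchy-Schwarz
    inequality ([riesz1_ideal]). The result is [atomic_of_psd].

    From a measure to an extension: the measure need not have moments of degree
    above 2n, so it is first replaced by finitely many atoms with the same
    moments up to 2n. On each piece its moments satisfy the ideal condition,
    because the integral of a nonnegative function vanishes only if the
    function does almost everywhere ([measure_hamburger], [measure_atomic]). The
    moments of the atoms in higher degree are the required extension
    ([extension_of_atomic]). *)

(** * Riesz functionals in one variable *)

Definition riesz1 (R : rcfType) (c : nat -> R) (f : {poly R}) : R :=
  \sum_(i < size f) f`_i * c i.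

Lemma riesz1E (R : rcfType) (c : nat -> R) (m : nat) (f : {poly R}) :
  (size f <= m)%N -> riesz1 c f = \sum_(i < m) f`_i * c i.
Proof.
move=> sfm; rewrite /riesz1 (big_ord_widen m (fun i => f`_i * c i)) //.
rewrite big_mkcond; apply: eq_bigr => i _; case: ltnP => // le_fi.
by rewrite nth_default // mul0r.
Qed.

Lemma riesz1_is_linear (R : rcfType) (c : nat -> R) : scalar (riesz1 c).
Proof.
move=> a f g; set m := maxn (size f) (size g).
have sfg : (size (a *: f + g)%R <= m)%N.
  by rewrite (leq_trans (size_polyD _ _)) // geq_max leq_maxr andbT
    (leq_trans (size_scale_leq _ _)) ?leq_maxl.
rewrite (riesz1E c sfg) (riesz1E c (leq_maxl _ _ : (size f <= m)%N)).
rewrite (riesz1E c (leq_maxr _ _ : (size g <= m)%N)).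
rewrite mulr_sumr -big_split; apply: eq_bigr => i _ /=.
by rewrite coefD coefZ mulrDl mulrA.
Qed.

HB.instance Definition _ (R : rcfType) (c : nat -> R) :=
  GRing.isLinear.Build R {poly R} R _ (riesz1 c) (riesz1_is_linear c).

Lemma riesz1Xn (R : rcfType) (c : nat -> R) (i : nat) : riesz1 c 'X^i = c i.
Proof.
rewrite (riesz1E c (_ : size 'X^i <= i.+1)%N) ?size_polyXn // big_ord_recr /=.
rewrite coefXn eqxx mul1r big1 ?add0r // => j _.
by rewrite coefXn (ltn_eqF (ltn_ord j)) mul0r.
Qed.

Lemma eq_riesz1 (R : rcfType) (c c' : nat -> R) (m : nat) (f : {poly R}) :
  (forall i, (i < m)%N -> c i = c' i) -> (size f <= m)%N ->
  riesz1 c f = riesz1 c' f.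
Proof.
move=> cc' sfm; rewrite (riesz1E c sfm) (riesz1E c' sfm).
by apply: eq_bigr => i _; rewrite cc'.
Qed.

Lemma riesz1_sqD (R : rcfType) (c : nat -> R) (f g : {poly R}) (t : R) :
  riesz1 c ((f + t *: g) ^+ 2) =
  riesz1 c (f ^+ 2) + (t *+ 2) * riesz1 c (f * g) + t ^+ 2 * riesz1 c (g ^+ 2).
Proof.
have -> : (f + t *: g) ^+ 2 = f ^+ 2 + (t *+ 2) *: (f * g) + t ^+ 2 *: (g ^+ 2).
  by rewrite -!mul_polyC !rmorphXn /= rmorphMn /=; ring.
by rewrite !linearD !linearZ.
Qed.

(** Cauchy-Schwarz: the value at (f + t g)^2 is a nonnegative polynomial in t, and
    without its constant term it can only be so if its linear term is zero. *)
Lemma riesz1_kernel (R : rcfType) (c : nat -> R) (d : nat) (f g : {poly R}) :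
  (forall h : {poly R}, (size h <= d)%N -> 0 <= riesz1 c (h ^+ 2)) ->
  (size f <= d)%N -> (size g <= d)%N -> riesz1 c (f ^+ 2) = 0 ->
  riesz1 c (f * g) = 0.
Proof.
move=> psd sf sg f0; set b := riesz1 c (f * g); set a := riesz1 c (g ^+ 2).
have ge0 t : 0 <= t ^+ 2 * a + (t *+ 2) * b.
  have : 0 <= riesz1 c ((f + t *: g) ^+ 2).
    apply: psd; rewrite (leq_trans (size_polyD _ _)) // geq_max sf.
    exact: leq_trans (size_scale_leq _ _) sg.
  by rewrite riesz1_sqD f0 add0r addrC.
have a0 : 0 <= a by exact: psd.
have := ge0 (- b / (a + 1)).
have -> : (- b / (a + 1)) ^+ 2 * a + ((- b / (a + 1)) *+ 2) * b =
          - ((b / (a + 1)) ^+ 2 * (a + 2)).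
  by field; rewrite gt_eqF // ltr_wpDl.
rewrite oppr_ge0 => h.
have : (b / (a + 1)) ^+ 2 = 0.
  apply/eqP; rewrite eq_le sqr_ge0 andbT.
  by rewrite -(pmulr_lle0 _ (_ : 0 < a + 2)) //; lra.
move/eqP; rewrite sqrf_eq0 mulf_eq0 invr_eq0 (gt_eqF (_ : 0 < a + 1)) ?orbF.
  by move/eqP.
by rewrite ltr_wpDl.
Qed.

(** A nonreal root a + i b contributes the factor (X - a)^2 + b^2; a repeated
    real root contributes the same factor with b = 0. *)
Lemma split_or_sos_dvdp (R : rcfType) (P : {poly R}) : P != 0 ->
  (exists2 rs : seq R, uniq rs &
     P = lead_coef P *: \prod_(r <- rs) ('X - r%:P)) \/
  (exists a b : R, ('X - a%:P) ^+ 2 + (b ^+ 2)%:P %| P).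
Proof.
move: {2}(size P) (leqnn (size P)) => m.
elim: m P => [|m IH] P; first by rewrite leqn0 size_poly_eq0 => ->.
move=> sP P0; have [/size1_polyC ->|sP1] := leqP (size P) 1.
  left; exists [::] => //; by rewrite big_nil lead_coefC alg_polyC.
pose C := R[i]%C; pose i2 : {rmorphism R -> C} := real_complex R.
have /closed_rootP [[a b] rz] : size (map_poly i2 P) != 1%N.
  by rewrite size_map_poly gtn_eqF.
have [b0|b0] := eqVneq b 0; last first.
  right; exists a, b; set s : {poly R} := _ + _.
  have ss : size s = 3%N.
    rewrite /s size_polyDl size_exp_XsubC // (leq_ltn_trans (size_polyC_leq1 _)) //.
  have sn0 : s != 0 by rewrite -size_poly_eq0 ss.
  have sr : (size (P %% s)%R <= 2)%N by rewrite -ltnS -ss ltn_modp.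
  have : root (map_poly i2 (P %% s)) (a +i* b)%C.
    move: rz; rewrite {1}(divp_eq P s) !rootE rmorphD rmorphM /= hornerD hornerM.
    suff -> : (map_poly i2 s).[(a +i* b)%C] = 0 by rewrite mulr0 add0r.
    rewrite /s rmorphD rmorphXn rmorphB /= map_polyX !map_polyC /= !hornerE.
    rewrite /i2 /=; apply/eqP; rewrite eq_complex /=.
    by apply/andP; split; apply/eqP; rewrite /=; ring.
  move: sr; set r := P %% s => sr.
  have -> : r = (r`_1)%:P * 'X + (r`_0)%:P.
    apply/polyP => i; rewrite coefD coefCM coefX coefC.
    case: i => [|[|i]] /=; rewrite ?mulr0 ?add0r ?mulr1 ?addr0 //.
    by rewrite nth_default // (leq_trans sr).
  rewrite rmorphD rmorphM /= map_polyX !map_polyC /= rootE !hornerE.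
  rewrite /i2 /= eq_complex /= => /andP [/eqP h1 /eqP h2].
  have r1 : r`_1 = 0.
    have : r`_1 * b = 0 by rewrite -[RHS]h2; ring.
    by move/eqP; rewrite mulf_eq0 (negPf b0) orbF => /eqP.
  have r0 : r`_0 = 0 by rewrite -[RHS]h1 r1; ring.
  apply/modp_eq0P; rewrite -/r; apply/polyP => i; rewrite coef0.
  case: i => [|[|i]] //; by rewrite nth_default // (leq_trans sr).
have ra : root P a by move: rz; rewrite b0 -(fmorph_root i2).
have /factor_theorem [Q PQ] := ra.
have Q0 : Q != 0 by apply: contraNneq P0 => Q0; rewrite PQ Q0 mul0r.
have sQ : (size Q <= m)%N.
  by move: sP; rewrite PQ size_Mmonic ?monicXsubC // size_XsubC addn2.
have [[rs urs Qrs]|[a' [b' dv]]] := IH Q sQ Q0; last first.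
  by right; exists a', b'; rewrite PQ dvdp_mulr.
have lPQ : lead_coef P = lead_coef Q by rewrite PQ lead_coef_Mmonic ?monicXsubC.
have [ars|ars] := boolP (a \in rs); last first.
  left; exists (a :: rs); first by rewrite /= ars.
  by rewrite lPQ big_cons {1}PQ {1}Qrs -scalerAl mulrC.
right; exists a, 0; rewrite expr0n /= addr0 PQ expr2 dvdp_mul //.
by rewrite Qrs dvdpZr ?lead_coef_eq0 // dvdp_XsubCl root_prod_XsubC.
Qed.

(** * Gauss quadrature *)

Section Gauss.
Variables (R : rcfType) (c : nat -> R) (d : nat) (P : {poly R}).
Hypotheses (monP : P \is monic) (sizeP : size P = d.+1).
Hypothesis orthP : forall h : {poly R}, (size h <= d)%N -> riesz1 c (P * h) = 0.
Hypothesis posdef : forall g : {poly R},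
  (size g <= d)%N -> g != 0 -> 0 < riesz1 c (g ^+ 2).

(** If [P] = h (u^2 + v^2), orthogonality to h says that the functional vanishes
    at (u h)^2 + (v h)^2, whose terms have low enough degree for
    definiteness. *)
Lemma orthopoly_split :
  exists2 rs : seq R, uniq rs & P = \prod_(r <- rs) ('X - r%:P).
Proof.
have P0 : P != 0 by rewrite monic_neq0.
have [[rs urs Prs]|[a [b /dvdpP [h Ph]]]] := split_or_sos_dvdp P0.
  by exists rs => //; rewrite Prs (eqP monP) scale1r.
have h0 : h != 0 by apply: contraNneq P0 => h0; rewrite Ph h0 mul0r.
have ss : size (('X - a%:P) ^+ 2 + (b ^+ 2)%:P) = 3%N.
  by rewrite size_polyDl size_exp_XsubC // (leq_ltn_trans (size_polyC_leq1 _)).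
have sh : (size h + 2 = d.+1)%N.
  rewrite -sizeP Ph size_mul // -?size_poly_eq0 ?ss // addn3 addn2.
  by [].
have := orthP (_ : (size h <= d)%N); rewrite -ltnS -sh addn2 leqnSn => /(_ isT).
have -> : P * h = (('X - a%:P) * h) ^+ 2 + (b%:P * h) ^+ 2.
  by rewrite Ph rmorphXn /=; ring.
rewrite linearD /= => sum0.
have pos : 0 < riesz1 c ((('X - a%:P) * h) ^+ 2).
  apply: posdef; last by rewrite mulf_neq0 ?polyXsubC_eq0.
  by rewrite size_monicM ?monicXsubC // size_XsubC -ltnS -sh addn2 ltnS leqnn.
suff : 0 <= riesz1 c ((b%:P * h) ^+ 2) by move: pos; lra.
have [->|bh] := eqVneq (b%:P * h) 0; first by rewrite expr0n linear0.
apply/ltW/posdef => //; rewrite mul_polyC (leq_trans (size_scale_leq _ _)) //.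
by rewrite -ltnS -sh addn2 leqnSn.
Qed.

(** The weights are the values of the functional at the Lagrange polynomials of
    the roots of [P]. They are nonnegative because a Lagrange polynomial and its
    square agree at the nodes, so that their difference is a multiple of [P]. *)
Lemma gauss_quadrature : exists2 atoms : seq (R * R),
  forall a, a \in atoms -> 0 <= a.1 /\ root P a.2 &
  forall f : {poly R}, (size f <= d.*2)%N ->
    riesz1 c f = \sum_(a <- atoms) a.1 * f.[a.2].
Proof.
have [rs urs Prs] := orthopoly_split.
have van (f : {poly R}) : (size f <= d.*2)%N -> all (root f) rs -> riesz1 c f = 0.
  move=> sf rf; have /dvdpP [h fh] : P %| f.
    by rewrite Prs uniq_roots_dvdp // uniq_rootsE.
  have [h0|h0] := eqVneq h 0; first by rewrite fh h0 mul0r linear0.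
  rewrite fh mulrC orthP //; move: sf; rewrite fh size_Mmonic // sizeP.
  by rewrite -addnn; lia.
pose Q r := \prod_(r' <- rem r rs) ('X - r'%:P).
have QP r : r \in rs -> P = ('X - r%:P) * Q r.
  by move=> rrs; rewrite Prs (big_rem r).
have Qmon r : Q r \is monic by exact: monic_prod_XsubC.
have sQ r : r \in rs -> size (Q r) = d.
  move=> rrs; have := sizeP; rewrite (QP r rrs) size_Mmonic ?polyXsubC_eq0 //.
  by rewrite size_XsubC => -[].
have Q_r_neq0 r : r \in rs -> (Q r).[r] != 0.
  move=> rrs; rewrite -[_ == 0]/(root (Q r) r) root_prod_XsubC.
  by rewrite mem_rem_uniq // !inE eqxx.
have QrN r r' : r' \in rs -> r' != r -> (Q r).[r'] = 0.
  move=> r'rs rr'; apply/eqP; rewrite -[_ == 0]/(root (Q r) r').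
  by rewrite root_prod_XsubC mem_rem_uniq // !inE rr'.
pose l r := (Q r).[r]^-1 *: Q r.
have sl r : r \in rs -> size (l r) = d.
  by move=> rrs; rewrite size_scale ?invr_eq0 ?Q_r_neq0 // sQ.
have lr r : r \in rs -> (l r).[r] = 1.
  by move=> rrs; rewrite hornerZ mulVf // Q_r_neq0.
have lrN r r' : r' \in rs -> r' != r -> (l r).[r'] = 0.
  by move=> r'rs rr'; rewrite hornerZ (QrN r r') ?mulr0.
exists [seq (riesz1 c (l r), r) | r <- rs] => [a /mapP [r rrs ->]/=|f sf].
  split; last by rewrite Prs root_prod_XsubC.
  have -> : riesz1 c (l r) = riesz1 c (l r ^+ 2).
    apply/eqP; rewrite -subr_eq0 -linearB; apply/eqP/van => /=.
      rewrite (leq_trans (size_polyD _ _)) // size_polyN geq_max sl //.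
      rewrite (leq_trans (size_polyMleq _ _)) ?sl -?addnn ?leq_addr //.
      by rewrite leq_pred.
    apply/allP => r' r'rs; rewrite rootE hornerD hornerN horner_exp.
    have [->|rr'] := eqVneq r' r; first by rewrite lr // expr1n subrr.
    by rewrite lrN // expr0n subr0.
  have [->|l0] := eqVneq (l r) 0; first by rewrite expr0n linear0.
  by apply/ltW/posdef => //; rewrite sl.
rewrite big_map /=; apply/eqP; rewrite -subr_eq0.
have -> : \sum_(r <- rs) riesz1 c (l r) * f.[r] =
    riesz1 c (\sum_(r <- rs) f.[r] *: l r).
  by rewrite linear_sum; apply: eq_bigr => r _; rewrite [RHS]linearZ mulrC.
rewrite -linearB /=; apply/eqP/van.
  rewrite (leq_trans (size_polyD _ _)) // size_polyN geq_max sf /=.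
  rewrite big_seq; apply: (leq_trans (size_sum _ _ _)).
  apply/bigmax_leqP_seq => r _ rrs; rewrite (leq_trans (size_scale_leq _ _)) //.
  by rewrite sl // -addnn leq_addr.
apply/allP => r' r'rs; rewrite rootE hornerD hornerN horner_sum.
rewrite (big_rem r') //= hornerZ lr // mulr1 big_seq big1 ?addr0 ?subrr // => r.
rewrite mem_rem_uniq // !inE => /andP [rr' rrs].
by rewrite hornerZ lrN ?mulr0 // eq_sym.
Qed.
End Gauss.

Lemma polyXn_expand (R : nzRingType) (m : nat) (h : {poly R}) :
  (size h <= m)%N -> h = \sum_(j < m) h`_j *: 'X^j.
Proof.
move=> sh; rewrite -poly_def; apply/polyP => i; rewrite coef_poly.
by case: ltnP => // ?; rewrite nth_default // (leq_trans sh).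
Qed.

Lemma riesz1_orth (R : rcfType) (c : nat -> R) (m : nat) (P : {poly R}) :
  (forall j, (j < m)%N -> riesz1 c (P * 'X^j) = 0) ->
  forall h : {poly R}, (size h <= m)%N -> riesz1 c (P * h) = 0.
Proof.
move=> orthP h sh.
rewrite (polyXn_expand sh) mulr_sumr linear_sum big1 // => j _.
by rewrite -scalerAr linearZ /= orthP ?mulr0.
Qed.

(** The Gram matrix of a definite form is invertible. *)
Lemma riesz1_solve (R : rcfType) (c : nat -> R) (m : nat) (v : nat -> R) :
  (forall g : {poly R}, (size g <= m)%N -> g != 0 -> 0 < riesz1 c (g ^+ 2)) ->
  exists2 r : {poly R}, (size r <= m)%N &
    forall j, (j < m)%N -> riesz1 c (r * 'X^j) = v j.
Proof.
move=> posdef; pose H : 'M[R]_m := \matrix_(i, j) c (i + j)%N.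
have HE (u : 'rV[R]_m) (j : 'I_m) : riesz1 c (rVpoly u * 'X^j) = (u *m H) 0 j.
  rewrite (polyXn_expand (size_poly _ _ : (size (rVpoly u) <= m)%N)).
  rewrite mulr_suml linear_sum mxE; apply: eq_bigr => i _.
  by rewrite -scalerAl -exprD linearZ /= riesz1Xn mxE coef_rVpoly_ord.
have : row_free H.
  apply: inj_row_free => u uH; apply/eqP; apply: contraT => u0.
  have : 0 < riesz1 c (rVpoly u ^+ 2).
    apply: posdef; first exact: size_poly.
    by apply: contraNneq u0 => u0; rewrite -(rVpolyK u) u0 linear0.
  rewrite expr2 (@riesz1_orth _ _ m) ?ltxx ?size_poly // => j jm.
  by rewrite (HE u (Ordinal jm)) uH mxE.
rewrite row_free_unit => uH.
exists (rVpoly ((\row_j v j) *m invmx H)) => [|j jm]; first exact: size_poly.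
by rewrite (HE _ (Ordinal jm)) mulmxKV // mxE.
Qed.

(** * Truncated moment problems in one variable *)

Section Quadrature.
Variables (R : rcfType) (c : nat -> R) (D : nat).

(** The orthogonal polynomial of degree D + 1 involves the moment of degree
    2D + 1, which is free; it is chosen so that 0 is not among the nodes. *)
Lemma definite_quadrature :
  (forall g : {poly R}, (size g <= D.+1)%N -> g != 0 -> 0 < riesz1 c (g ^+ 2)) ->
  exists2 atoms : seq (R * R), forall a, a \in atoms -> 0 <= a.1 /\ a.2 != 0 &
    forall m, (m <= D.*2)%N -> c m = \sum_(a <- atoms) a.1 * a.2 ^+ m.
Proof.
move=> posdef; pose c_ (s : R) i := if i == D.*2.+1 then s else c i.
have cE s (f : {poly R}) : (size f <= D.*2.+1)%N -> riesz1 (c_ s) f = riesz1 c f.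
  by apply: eq_riesz1 => i iD; rewrite /c_ ltn_eqF.
have [r0 sr0 r0E] := riesz1_solve (fun j => c_ 0 (D.+1 + j)%N) posdef.
have [r1 sr1 r1E] := riesz1_solve (fun j => (j == D)%:R) posdef.
pose P s := 'X^(D.+1) - (r0 + s *: r1).
have sr s : (size (r0 + s *: r1)%R <= D.+1)%N.
  rewrite (leq_trans (size_polyD _ _)) // geq_max sr0.
  exact: leq_trans (size_scale_leq _ _) sr1.
have sP s : size (P s) = D.+2.
  by rewrite size_polyDl ?size_polyN size_polyXn // ltnS.
have monP s : P s \is monic.
  by rewrite monicE lead_coefDl ?lead_coefXn // size_polyN size_polyXn ltnS.
have orthP s (h : {poly R}) : (size h <= D.+1)%N -> riesz1 (c_ s) (P s * h) = 0.
  apply: riesz1_orth => j jD; rewrite mulrBl linearB /= -exprD riesz1Xn.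
  rewrite cE; last first.
    rewrite (leq_trans (size_polyMleq _ _)) // size_polyXn addnS /=.
    by rewrite -addnn -addSn leq_add.
  rewrite mulrDl -scalerAl linearD linearZ /= r0E // r1E // /c_.
  have -> : (D.+1 + j == D.*2.+1)%N = (j == D).
    by rewrite -addnn addSn eqSS eqn_add2l.
  by case: eqP => _; rewrite ?mulr1 ?add0r ?subrr // mulr0 addr0 subrr.
(* Some s in {0, 1} works: P s depends affinely on s, with slope - r1. Were 0 a
   root of both P 0 = P' * 'X and r1 = r1' * 'X, then P 0 * r1' and r1 * P' would
   be the same polynomial, although the functional vanishes on the former, by
   orthogonality of P 0, and is 1 on the latter, P' being monic of degree D. *)
have [s Ps0] : exists s, ~~ root (P s) 0.
  have [|] := boolP (root (P 0) 0); last by exists 0.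
  have [|r10 P00] := boolP (root r1 0); last first.
    exists 1; apply: contra r10 => /eqP; move: P00 => /eqP.
    rewrite /P !(hornerD, hornerN, hornerZ, hornerXn) => P00 P10.
    by apply/eqP; lra.
  move=> /factor_theorem [r1']; rewrite subr0 => r1r' /factor_theorem [P'].
  rewrite subr0 => PP'.
  have monP' : P' \is monic by have := monP 0; rewrite PP' monicMr ?monicX.
  have sP' : size P' = D.+1.
    by have := sP 0; rewrite PP' size_mulX ?monic_neq0 // => -[].
  have : riesz1 (c_ 0) (P 0 * r1') = 0.
    apply: orthP; have [->|r0'] := eqVneq r1' 0; first by rewrite size_poly0.
    by apply: leq_trans sr1; rewrite r1r' size_mulX.
  have -> : P 0 * r1' = r1 * P' by rewrite PP' r1r'; ring.
  have -> : r1 * P' = r1 * (P' - 'X^D) + r1 * 'X^D by ring.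
  have sX : (size (P' - 'X^D)%R <= D)%N.
    apply/leq_sizeP => j; rewrite leq_eqVlt => /orP [/eqP <-|Dj].
      have := monicP monP'; rewrite lead_coefE sP' /= => P'D.
      by rewrite coefB P'D coefXn eqxx subrr.
    by rewrite coefB nth_default ?sP' // coefXn gtn_eqF ?subrr.
  have sM (f : {poly R}) : (size f <= D.+1)%N -> (size (r1 * f)%R <= D.*2.+1)%N.
    move=> sf; rewrite (leq_trans (size_polyMleq _ _)) //.
    by have := leq_add sr1 sf; rewrite -addnn; lia.
  rewrite linearD /= cE ?sM ?(leq_trans sX) //.
  rewrite (@riesz1_orth _ _ D) // => [|j jD]; last first.
    by rewrite r1E ?(ltn_eqF jD) // ltnS ltnW.
  rewrite cE ?sM ?size_polyXn // r1E // eqxx add0r => /eqP.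
  by rewrite oner_eq0.
have posdef' (g : {poly R}) :
    (size g <= D.+1)%N -> g != 0 -> 0 < riesz1 (c_ s) (g ^+ 2).
  move=> sg g0; rewrite cE ?posdef // expr2 (leq_trans (size_polyMleq _ _)) //.
  by have := leq_add sg sg; rewrite -addnn; lia.
have [atoms atP atE] := gauss_quadrature (monP s) (sP s) (orthP s) posdef'.
exists atoms => [a /atP [? ra]|m mD].
  by split=> //; apply: contraNneq Ps0 => <-.
rewrite -riesz1Xn -(cE s) ?size_polyXn ?ltnS // atE; last first.
  by rewrite size_polyXn doubleS ltnS (leq_trans mD).
by apply: eq_bigr => a _; rewrite hornerXn.
Qed.

Hypothesis psd : forall g : {poly R},
  (size g <= D.+1)%N -> 0 <= riesz1 c (g ^+ 2).
Hypothesis ideal : forall g h : {poly R},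
  (size g <= D.+1)%N -> riesz1 c (g ^+ 2) = 0 ->
  (size (g * h)%R <= D.*2.+1)%N -> riesz1 c (g * h) = 0.

(** In the degenerate case the nodes are the roots of a monic [g] of least degree
    with killed square: the form is definite below the degree of [g], and by the
    ideal condition [g] is orthogonal to everything, so the quadrature formula
    extends from remainders modulo [g] to all degrees up to 2D. The flag [b]
    asks for nodes on the nonzero reals: its condition keeps the least [g] from
    being divisible by 'X. *)
Lemma truncated_hamburger (b : bool) :
  (b -> forall g : {poly R}, (size g <= D)%N ->
     riesz1 c (('X * g) ^+ 2) = 0 -> riesz1 c (g ^+ 2) = 0) ->
  exists2 atoms : seq (R * R),
    forall a, a \in atoms -> 0 <= a.1 /\ (b -> a.2 != 0) &
    forall m, (m <= D.*2)%N -> c m = \sum_(a <- atoms) a.1 * a.2 ^+ m.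
Proof.
move=> nz0.
pose ker k := `[< exists2 g : {poly R},
  [/\ size g = k, (size g <= D.+1)%N & g != 0] & riesz1 c (g ^+ 2) = 0 >].
have [exker|noker] := pselect (exists k, ker k); last first.
  have [|atoms atP atE] := definite_quadrature.
    move=> g sg g0; rewrite lt_neqAle psd // andbT; apply/eqP => hg.
    by apply: noker; exists (size g); apply/asboolP; exists g.
  by exists atoms => // a /atP [? ?].
case: (ex_minnP exker) => k /asboolP [g0 [sg0 sD g0n0] hg0] kmin.
pose g := (lead_coef g0)^-1 *: g0.
have lg0 : (lead_coef g0)^-1 != 0 by rewrite invr_eq0 lead_coef_eq0.
have sg : size g = k by rewrite size_scale.
have gn0 : g != 0 by rewrite scaler_eq0 negb_or lg0.
have mong : g \is monic by rewrite monicE lead_coefZ mulVf ?lead_coef_eq0.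
have hg : riesz1 c (g ^+ 2) = 0 by rewrite exprZn linearZ /= hg0 mulr0.
have sgD : (size g <= D.+1)%N by rewrite sg -sg0.
pose d := k.-1.
have sgd : size g = d.+1 by rewrite /d -sg prednK // lt0n size_poly_eq0.
have dD : (d <= D)%N by rewrite -ltnS -sgd.
have posdef (h : {poly R}) : (size h <= d)%N -> h != 0 -> 0 < riesz1 c (h ^+ 2).
  move=> sh hn0; rewrite lt_neqAle psd ?andbT; last first.
    by rewrite (leq_trans sh) // (leq_trans dD).
  apply/eqP => hh; suff : (k <= size h)%N by rewrite -sg sgd leqNgt ltnS sh.
  apply: kmin; apply/asboolP; exists h => //; split=> //.
  by rewrite (leq_trans sh) // (leq_trans dD).
have orth (h : {poly R}) : (size h <= d)%N -> riesz1 c (g * h) = 0.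
  move=> sh; apply: ideal => //; rewrite (leq_trans (size_polyMleq _ _)) //.
  by rewrite sgd addSn -addnn /= ltnW // ltnS leq_add // (leq_trans sh).
have [atoms atP atE] := gauss_quadrature mong sgd orth posdef.
exists atoms => [a /atP [a1 ra]|m mD].
  split=> // bT; apply/eqP => a20; move: ra; rewrite a20 => /factor_theorem [h].
  rewrite subr0 => gh.
  have hn0 : h != 0 by apply: contraNneq gn0 => h0; rewrite gh h0 mul0r.
  have sh : size h = d by have := sgd; rewrite gh size_mulX // => -[].
  have := posdef h; rewrite sh nz0 ?ltxx ?sh //.
    by move=> /(_ (leqnn _) hn0).
  by rewrite mulrC -gh.
rewrite -riesz1Xn (divp_eq 'X^m g) linearD /= mulrC.
have s_mod : (size ('X^m %% g)%R <= d)%N by rewrite -ltnS -sgd ltn_modp.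
rewrite ideal //; last first.
  have [q0|q0] := eqVneq ('X^m %/ g) 0; first by rewrite q0 mulr0 size_poly0.
  have -> : g * ('X^m %/ g) = 'X^m - 'X^m %% g by rewrite {2}(divp_eq 'X^m g); ring.
  rewrite (leq_trans (size_polyD _ _)) // size_polyN size_polyXn geq_max.
  rewrite ltnS mD (leq_trans s_mod) // (leq_trans dD) // -addnn ltnW // ltnS.
  exact: leq_addr.
rewrite add0r atE; last by rewrite (leq_trans s_mod) // -addnn leq_addr.
rewrite !big_seq; apply: eq_bigr => a /atP [_ /eqP ra]; congr (_ * _).
by rewrite -[in RHS]hornerXn {2}(divp_eq 'X^m g) hornerD hornerM ra mulr0 add0r.
Qed.
End Quadrature.

(** As (X e)^2 = e (X^2 e), Cauchy-Schwarz shows that multiplication by 'X, below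
    the top degree, preserves the polynomials with killed square. Hence all
    shifts of [g] that leave room are orthogonal to all admissible
    polynomials. *)
Lemma riesz1_ideal (R : rcfType) (c : nat -> R) (E : nat) (g h : {poly R}) :
  (forall f : {poly R}, (size f <= E.+1)%N -> 0 <= riesz1 c (f ^+ 2)) ->
  (size g <= E)%N -> riesz1 c (g ^+ 2) = 0 -> (size (g * h)%R <= E.*2)%N ->
  riesz1 c (g * h) = 0.
Proof.
move=> psd sg hg sgh; have [g0|gn0] := eqVneq g 0; first by rewrite g0 mul0r linear0.
have [h0|hn0] := eqVneq h 0; first by rewrite h0 mulr0 linear0.
have ker e : (e + size g <= E)%N -> riesz1 c (('X^e * g) ^+ 2) = 0.
  elim: e => [|e IH] eg; first by rewrite expr0 mul1r.
  have -> : ('X^(e.+1) * g) ^+ 2 = ('X^e * g) * ('X^(e.+2) * g).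
    by rewrite !exprS; ring.
  apply: (@riesz1_kernel _ _ E.+1) => //; last by apply: IH; exact: ltnW.
    by rewrite size_monicM ?monicXn // size_polyXn; lia.
  by rewrite size_monicM ?monicXn // size_polyXn; lia.
apply: (@riesz1_orth _ _ (size h)) => // j jh.
have sgh' : (size g + size h <= E.*2.+1)%N.
  by move: sgh; rewrite size_mul // -subn1 leq_subLR add1n.
pose e := minn j (E - size g)%N.
have -> : g * 'X^j = ('X^e * g) * 'X^(j - e).
  by rewrite -mulrA mulrCA -exprD subnKC // geq_minl.
apply: (@riesz1_kernel _ _ E.+1) => //.
- by rewrite size_monicM ?monicXn // size_polyXn /e; lia.
- by rewrite size_polyXn /e; lia.
- by apply: ker; rewrite /e; lia.
Qed.

(** * Atoms on the line and on the curve *)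

Definition atomic_moments (R : rcfType) (Z : R -> R -> Prop) (d : nat)
    (G : nat -> nat -> R) : Prop :=
  exists2 atoms : seq (R * (R * R)),
    forall a, a \in atoms -> 0 <= a.1 /\ Z a.2.1 a.2.2 &
    forall i j, (i + j <= d)%N ->
      G i j = \sum_(a <- atoms) a.1 * (a.2.1 ^+ i * a.2.2 ^+ j).

Definition line_or_curve (R : rcfType) (l1 l2 : nat) (x y : R) : Prop :=
  x * (x ^+ l1 * y ^+ l2 - 1) = 0.

(** The moments [cl] live on the line x = 0 and see only the powers of y, whence
    the factor (i == 0). The moments [cc] live on the curve, parametrized by
    (t^l2, t^-l1), with exponents shifted by 2 n l1 to make them nonnegative;
    the weight t^(2 n l1) undoes the shift. *)
Lemma assemble_atoms (R : rcfType) (l1 l2 n : nat) (G : nat -> nat -> R)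
    (cl cc : nat -> R) (atl atc : seq (R * R)) :
  (0 < l1)%N ->
  (forall a, a \in atl -> 0 <= a.1) ->
  (forall a, a \in atc -> 0 <= a.1 /\ a.2 != 0) ->
  (forall m, (m <= n.*2)%N -> cl m = \sum_(a <- atl) a.1 * a.2 ^+ m) ->
  (forall m, (m <= (n * l1 + n * l2).*2)%N ->
     cc m = \sum_(a <- atc) a.1 * a.2 ^+ m) ->
  (forall i j, (i + j <= n.*2)%N ->
     G i j = (i == 0%N)%:R * cl j + cc ((n * l1).*2 + l2 * i - l1 * j)%N) ->
  atomic_moments (line_or_curve l1 l2) n.*2 G.
Proof.
move=> l1_gt0 atlP atcP clE ccE GE.
exists ([seq (a.1, (0, a.2)) | a <- atl] ++
  [seq (a.1 * a.2 ^+ (n * l1).*2, (a.2 ^+ l2, a.2 ^- l1)) | a <- atc]).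
  move=> p; rewrite mem_cat => /orP [] /mapP [a ain ->] /=.
    by split; [exact: atlP | rewrite /line_or_curve mul0r].
  have [a1 a2] := atcP _ ain; split.
    by rewrite mulr_ge0 // -muln2 exprM sqr_ge0.
  rewrite /line_or_curve -!exprM -exprVn -!exprM mulnC exprVn divff ?subrr ?mulr0 //.
  by rewrite expf_neq0.
move=> i j ij; rewrite GE // big_cat !big_map /=; congr (_ + _).
  rewrite clE; last by rewrite (leq_trans _ ij) // leq_addl.
  by rewrite mulr_sumr; apply: eq_bigr => a _; rewrite expr0n; ring.
have jA : (l1 * j <= (n * l1).*2)%N.
  by rewrite doubleMl mulnC leq_mul // (leq_trans _ ij) // leq_addl.
have iB : (l2 * i <= (n * l2).*2)%N.
  by rewrite doubleMl mulnC leq_mul // (leq_trans _ ij) // leq_addr.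
rewrite ccE; last first.
  by rewrite doubleD leq_subLR addnCA leq_add2l (leq_trans iB) // leq_addl.
rewrite !big_seq; apply: eq_bigr => a /atcP [_ a2].
rewrite -mulrA; congr (_ * _); rewrite -!exprM -exprVn -exprM exprVn.
rewrite mulrA -exprD -[RHS]mulr1.
apply: (@mulIf _ (a.2 ^+ (l1 * j))); first by rewrite expf_neq0.
by rewrite -exprD subnK ?(leq_trans jA) ?leq_addr // mulr1 mulfVK // expf_neq0.
Qed.

(** A solution j of a j = - e modulo b can be taken below b, which leaves
    b i < b (n + a). *)
Lemma exponent_rep (a b n e : nat) : (1 < a)%N -> (0 < b)%N -> coprime a b ->
  (e <= n * b + 1)%N ->
  exists i j, (b * i = e + a * j)%N /\ (i + j <= n + a + b - 2)%N.
Proof.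
move=> a1 b0 cab eb.
have [u v uv _] := egcdnP b (ltnW a1).
rewrite (eqP cab) in uv.
(* As u * a = 1 modulo b, this j solves a * j = - e modulo b; the factor b - 1
   stands for the minus sign. *)
pose j := ((e * (b - 1) * u) %% b)%N.
have jb : (j < b)%N by rewrite ltn_mod.
have /dvdnP [i eE] : (b %| e + a * j)%N.
  rewrite /dvdn -modnDmr /j modnMmr modnDmr.
  have -> : (e + a * (e * (b - 1) * u) = e * (b + (b - 1) * v * b))%N.
    have -> : (a * (e * (b - 1) * u) = e * (b - 1) * (u * a))%N by ring.
    rewrite uv; case: b b0 {cab eb uv j jb} => // b _.
    by rewrite subSS subn0; ring.
  by rewrite -/(dvdn _ _) dvdn_mull // dvdn_add // dvdn_mull.
exists i, j; split; first by rewrite mulnC.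
have : (b * i < b * (n + a))%N.
  have aj : (a * j <= a * (b - 1))%N by rewrite leq_mul2l; lia.
  rewrite [(b * i)%N]mulnC -eE (leq_ltn_trans (leq_add eb aj)) //.
  have ab : (a <= a * b)%N by rewrite leq_pmulr.
  by rewrite mulnDr mulnBr muln1 [(b * n)%N]mulnC [(b * a)%N]mulnC; lia.
by rewrite ltn_mul2l => /andP [_]; lia.
Qed.

(** * Positive functionals vanishing on the multiples of p *)

Definition psd_moments (R : rcfType) (d : nat) (G : nat -> nat -> R) : Prop :=
  forall (I : finType) (a : I -> R) (e f : I -> nat),
    (forall k, (e k + f k <= d)%N) ->
    0 <= \sum_k \sum_l a k * a l * G (e k + e l)%N (f k + f l)%N.

Lemma riesz1_sq (R : rcfType) (c : nat -> R) (m : nat) (f : {poly R}) :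
  (size f <= m)%N ->
  riesz1 c (f ^+ 2) = \sum_(k < m) \sum_(l < m) f`_k * f`_l * c (k + l)%N.
Proof.
move=> sf; rewrite expr2 {1 2}(polyXn_expand sf) mulr_suml linear_sum.
apply: eq_bigr => k _; rewrite mulr_sumr linear_sum; apply: eq_bigr => l _.
by rewrite -scalerAl -scalerAr scalerA linearZ /= -exprD riesz1Xn.
Qed.

(** [G i j] stands for the value of a functional at x^i y^j; [shiftG] says that it
    vanishes on the multiples of x (x^l1 y^l2 - 1) of low degree. *)
Section AtomicOfPsd.
Variables (R : rcfType) (l1 l2 n : nat) (G : nat -> nat -> R).
Hypotheses (l1_gt1 : (1 < l1)%N) (l2_gt1 : (1 < l2)%N).
Let s := (l1 + l2)%N.
Hypothesis psdG : psd_moments (n + 2 * s) G.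
Hypothesis shiftG : forall i j, (i + j <= 2 * n + 3 * s - 2)%N ->
  G (i.+1 + l1)%N (j + l2)%N = G i.+1 j.

(** The product with 1 - x^l1 y^l2. This polynomial is its own square modulo p, so
    positivity of the product follows from squares of combinations of the
    y^j - x^l1 y^(j + l2). *)
Lemma line_moments : exists2 atl : seq (R * R),
  forall a, a \in atl -> 0 <= a.1 &
  forall m, (m <= n.*2)%N ->
    G 0%N m - G l1 (m + l2)%N = \sum_(a <- atl) a.1 * a.2 ^+ m.
Proof.
pose c m := G 0%N m - G l1 (m + l2)%N.
have psd (g : {poly R}) : (size g <= n.+2)%N -> 0 <= riesz1 c (g ^+ 2).
  move=> sg; rewrite (riesz1_sq _ sg).
  (* The monomials of the combination of the y^j (left) and of the
     - x^l1 y^(j + l2) (right). *)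
  pose I := ('I_n.+2 + 'I_n.+2)%type.
  pose a (k : I) := match k with inl k => g`_k | inr k => - g`_k end.
  pose e (k : I) := match k with inl k => 0%N | inr k => l1 end.
  pose f (k : I) := match k with inl k => k : nat | inr k => (k + l2)%N end.
  have := @psdG I a e f; rewrite big_sumType /=.
  under eq_bigr => k _ do rewrite big_sumType /=.
  under [X in _ + X]eq_bigr => k _ do rewrite big_sumType /=.
  rewrite -big_split /= => /(_ _) h; apply: le_trans (h _) _.
    by case=> k /=; have := ltn_ord k; rewrite /s; lia.
  rewrite le_eqVlt; apply/orP; left; apply/eqP; apply: eq_bigr => k _.
  rewrite -!big_split /=; apply: eq_bigr => l _.
  have -> : G (l1 + l1)%N (k + l2 + (l + l2))%N = G l1 (k + l + l2)%N.
    have -> : (k + l2 + (l + l2) = (k + l + l2) + l2)%N by ring.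
    have := @shiftG l1.-1 (k + l + l2)%N; rewrite prednK ?(ltnW l1_gt1) //.
    apply; have := ltn_ord k; have := ltn_ord l.
    by have := l1_gt1; have := l2_gt1; rewrite /s; lia.
  rewrite /c !add0n addn0 addnA.
  have -> : (k + l2 + l = k + l + l2)%N by ring.
  ring.
have [|||atoms atP atE] := @truncated_hamburger R c n _ _ false.
- by move=> g sg; apply: psd; rewrite (leq_trans sg).
- move=> g h sg hg sgh; apply: (@riesz1_ideal R c n.+1) => //.
  by rewrite doubleS (leq_trans sgh).
- by [].
by exists atoms => // a /atP [].
Qed.

(** The product with x^l1 y^l2, whose values are the [G (i + l1) (j + l2)], does
    not change under multiplication by x^l1 y^l2. *)
Lemma curve_shift (r i j : nat) :
  (i + r * l1 + (j + r * l2) <= 2 * n + 3 * s - 1)%N ->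
  G (i + r * l1 + l1) (j + r * l2 + l2) = G (i + l1)%N (j + l2)%N.
Proof.
elim: r => [|r IH] h; first by rewrite !mul0n !addn0.
rewrite -IH; last by move: h; rewrite !mulSn; lia.
have := @shiftG (i + r * l1 + l1).-1 (j + r * l2 + l2).
rewrite prednK ?addn_gt0 ?(ltnW l1_gt1) ?orbT //.
have -> : (i + r.+1 * l1 + l1 = i + r * l1 + l1 + l1)%N by rewrite mulSn; ring.
have -> : (j + r.+1 * l2 + l2 = j + r * l2 + l2 + l2)%N by rewrite mulSn; ring.
by apply; move: h; rewrite !mulSn /s; move: (r * l1)%N (r * l2)%N => u v; lia.
Qed.

Hypothesis col12 : coprime l1 l2.

(** Two monomials that restrict to the same power of t differ by a power of
    x^l1 y^l2, by coprimality. *)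
Lemma curve_invariant (i j i' j' : nat) :
  (l2 * i + l1 * j' = l2 * i' + l1 * j)%N ->
  (i + j <= 2 * (n + s - 1))%N -> (i' + j' <= 2 * (n + s - 1))%N ->
  G (i + l1)%N (j + l2)%N = G (i' + l1)%N (j' + l2)%N.
Proof.
wlog ii' : i j i' j' / (i <= i')%N.
  move=> wl e h h'; have [|/ltnW] := leqP i i'; first by move=> ?; apply: wl.
  by move=> ?; apply/esym/wl.
move=> e h h'.
have e' : (l2 * (i' - i) = l1 * (j' - j))%N by rewrite !mulnBr; lia.
have /dvdnP [r rE] : (l1 %| i' - i)%N.
  by rewrite -(Gauss_dvdr _ col12) e' dvdn_mulr.
have rE2 : (j' - j = r * l2)%N.
  apply/eqP; rewrite -(@eqn_pmul2l l1) ?(ltnW l1_gt1) // -e' rE; apply/eqP; ring.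
have jj' : (j <= j')%N.
  have : (l1 * j <= l1 * j')%N.
    have : (l2 * i <= l2 * i')%N by rewrite leq_mul2l ii' orbT.
    by move: e; lia.
  by rewrite leq_mul2l; have := l1_gt1; lia.
have iE : i' = (i + r * l1)%N by lia.
have jE : j' = (j + r * l2)%N by lia.
by rewrite iE jE curve_shift // -iE -jE; have := l1_gt1; rewrite /s; lia.
Qed.

(** The moments in t are taken on a window that exceeds the required one by one
    exponent at each end before squaring, that is by two at each end for the
    functional: multiplication by 'X then embeds the required window strictly
    inside, and [riesz1_ideal] applies. *)
Lemma curve_moments : exists (cc : nat -> R) (atc : seq (R * R)),
  [/\ forall a, a \in atc -> 0 <= a.1 /\ a.2 != 0,
     forall m, (m <= (n * l1 + n * l2).*2)%N ->
       cc m = \sum_(a <- atc) a.1 * a.2 ^+ m &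
     forall i j, (i + j <= n.*2)%N ->
       G (i + l1)%N (j + l2)%N = cc ((n * l1).*2 + l2 * i - l1 * j)%N].
Proof.
pose A := (n * l1)%N; pose D := (n * l1 + n * l2)%N.
(* [rep a] is a monomial that restricts to t ^ (a - (A + 1)). *)
have [rep repP] : exists rep : nat -> nat * nat, forall a, (a <= D + 2)%N ->
    (l2 * (rep a).1 + A + 1 = a + l1 * (rep a).2)%N /\
    ((rep a).1 + (rep a).2 <= n + s - 2)%N.
  suff /choice [rep repP] : forall a, exists ij : nat * nat, (a <= D + 2)%N ->
      (l2 * ij.1 + A + 1 = a + l1 * ij.2)%N /\ (ij.1 + ij.2 <= n + s - 2)%N.
    by exists rep.
  move=> a; have [aD|_] := boolP (a <= D + 2)%N; last by exists (0%N, 0%N).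
  have [aA|Aa] := leqP (A + 1) a.
    have [||i [j [ij1 ij2]]] := @exponent_rep l1 l2 n (a - (A + 1)) l1_gt1 _ col12.
    - exact: ltnW.
    - by move: aD; rewrite /D /A; lia.
    by exists (i, j) => _ /=; split; move: ij1 ij2; rewrite /s; lia.
  have [|||j [i [ij1 ij2]]] := @exponent_rep l2 l1 n (A + 1 - a) l2_gt1 _ _.
  - exact: ltnW.
  - by rewrite coprime_sym.
  - by rewrite /A; lia.
  by exists (i, j) => _ /=; split; move: ij1 ij2; rewrite /s; lia.
(* The moment of t ^ (m - 2 (A + 1)), read off a product of two such monomials. *)
pose cN m := let a := m./2 in let b := (m - m./2)%N in
  G ((rep a).1 + (rep b).1 + l1)%N ((rep a).2 + (rep b).2 + l2)%N.
have cNE i j m : (m <= (D + 2).*2)%N -> (i + j <= 2 * (n + s - 1))%N ->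
    (l2 * i + (A + 1).*2 = m + l1 * j)%N -> cN m = G (i + l1)%N (j + l2)%N.
  move=> mD ij e.
  have aD : (m./2 <= D + 2)%N by lia.
  have bD : (m - m./2 <= D + 2)%N by lia.
  have [a1 a2] := repP _ aD; have [b1 b2] := repP _ bD.
  by rewrite /cN; apply: curve_invariant => //; rewrite ?mulnDr; lia.
have psd (g : {poly R}) : (size g <= (D + 2).+1)%N -> 0 <= riesz1 cN (g ^+ 2).
  move=> sg; rewrite (riesz1_sq _ sg).
  have := @psdG 'I_(D + 2).+1 (fun k => g`_k)
    (fun k => (rep k).1 + l1)%N (fun k => (rep k).2 + l2)%N.
  move=> /(_ _) h; apply: le_trans (h _) _.
    move=> k; have [_] := repP k (ltn_ord k); rewrite /s; lia.
  rewrite le_eqVlt; apply/orP; left; apply/eqP.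
  apply: eq_bigr => k _; apply: eq_bigr => l _; congr (_ * _).
  have [k1 k2] := repP k (ltn_ord k); have [m1 m2] := repP l (ltn_ord l).
  have kl : (k + l <= (D + 2).*2)%N.
    by have := ltn_ord k; have := ltn_ord l; lia.
  rewrite (@cNE ((rep k).1 + (rep l).1)%N ((rep k).2 + (rep l).2)%N) //; first last.
  - by rewrite !mulnDr; lia.
  - by lia.
  have := @curve_shift 1 ((rep k).1 + (rep l).1)%N ((rep k).2 + (rep l).2)%N.
  rewrite !mul1n => <-; last by rewrite /s; lia.
  by congr (G _ _); ring.
pose cc m := cN m.+2.
have ccX (f : {poly R}) : riesz1 cc f = riesz1 cN ('X ^+ 2 * f).
  rewrite (polyXn_expand (leqnn (size f))) mulr_sumr !linear_sum.
  apply: eq_bigr => i _; rewrite -scalerAr !linearZ /= -exprD !riesz1Xn.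
  by [].
have sX (g : {poly R}) : (size ('X * g)%R <= (size g).+1)%N.
  by rewrite (leq_trans (size_polyMleq _ _)) // size_polyX.
have [|||atoms atP atE] := @truncated_hamburger R cc D _ _ true.
- move=> g sg; rewrite ccX -exprMn; apply: psd.
  by rewrite (leq_trans (sX g)) // addn2 ltnS (leq_trans sg).
- move=> g h sg; rewrite ccX -exprMn => hg sgh.
  rewrite ccX; have -> : 'X ^+ 2 * (g * h) = ('X * g) * ('X * h) by ring.
  apply: (@riesz1_ideal R cN (D + 2)) => //.
    by rewrite (leq_trans (sX g)) // addn2 ltnS.
  have -> : ('X * g) * ('X * h) = 'X * ('X * (g * h)) by ring.
  rewrite (leq_trans (sX _)) // doubleD (leq_ltn_trans (sX _)) //.
  by rewrite (_ : 2.*2 = 4)%N // addn4 !ltnS (leq_trans sgh).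
- move=> _ g sg; rewrite !ccX -!exprMn => hg.
  have -> : ('X * g) ^+ 2 = ('X * ('X * g)) * g by ring.
  apply: (@riesz1_kernel R cN (D + 2).+1) => //.
    rewrite (leq_trans (sX _)) // ltnS (leq_trans (sX _)) // addn2.
    by rewrite (leq_trans _ (leqnSn _)).
  by rewrite (leq_trans sg) // ltnW // ltnS leq_addr.
exists cc, atoms; split=> [a /atP []|m mD|i j ij].
- by move=> ? /(_ isT).
- exact: atE.
have jA : (l1 * j <= A.*2)%N.
  by rewrite doubleMl mulnC leq_mul // (leq_trans _ ij) // leq_addl.
have iB : (l2 * i <= (n * l2).*2)%N.
  by rewrite doubleMl mulnC leq_mul // (leq_trans _ ij) // leq_addr.
rewrite /cc (@cNE i j) //; rewrite ?/D -/A; move: ij; rewrite /s; lia.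
Qed.

Lemma atomic_of_psd : atomic_moments (line_or_curve l1 l2) n.*2 G.
Proof.
have [atl atlP atlE] := line_moments.
have [cc [atc [atcP atcE ccE]]] := curve_moments.
apply: (assemble_atoms (ltnW l1_gt1) atlP atcP (cl := fun m => _) atlE atcE).
move=> [|i] j ij; rewrite -ccE //=; first by rewrite mul1r subrK.
by rewrite mul0r add0r shiftG //; move: ij; rewrite /s; lia.
Qed.

End AtomicOfPsd.

(** * Moment and localizing matrices *)

Section Riesz.
Variable R : realType.
Implicit Types f g q : bipoly R.

Lemma riesz_is_linear (d : nat) (beta : tseq R d) : scalar (riesz beta).
Proof.
move=> a f g; rewrite /riesz mulr_sumr -big_split; apply: eq_bigr => u _ /=.
by rewrite mcoeffD mcoeffZ mulrDl mulrA.
Qed.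

HB.instance Definition _ (d : nat) (beta : tseq R d) :=
  GRing.isLinear.Build R (bipoly R) R _ (riesz beta) (riesz_is_linear beta).

Lemma riesz_mon (d : nat) (beta : tseq R d) (u : monomial d) :
  riesz beta (mpolyX R u) = beta u.
Proof.
rewrite /riesz (bigD1 u) //= mcoeffX eqxx mul1r big1 ?addr0 // => v vu.
by rewrite mcoeffX -bmeqP eq_sym (negPf vu) mul0r.
Qed.

Lemma mpolyX_xy (u : multinom 2) :
  mpolyX R u = polyx R ^+ u ord0 * polyy R ^+ u ord_max.
Proof.
rewrite mpolyXE_id big_ord_recl big_ord1 /polyx /polyy.
by congr (_ * mpolyX R (mnm1 _) ^+ u _); apply: val_inj.
Qed.

Lemma mdeg2 (u : multinom 2) : mdeg u = (u ord0 + u ord_max)%N.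
Proof.
rewrite mdegE big_ord_recl big_ord1; congr (_ + u _)%N; exact: val_inj.
Qed.

Lemma xy_mpolyX (i j : nat) : exists2 u : multinom 2,
  u ord0 = i /\ u ord_max = j & polyx R ^+ i * polyy R ^+ j = mpolyX R u.
Proof.
exists (mnm_add (mnm_muln (mnm1 ord0) i) (mnm_muln (mnm1 ord_max) j)).
  by rewrite !mnmDE !mulmnE !mnm1E /= !mul1n !mul0n addn0.
by rewrite mpolyXD -!mpolyXn.
Qed.

Lemma msize_xy (i j : nat) :
  mmeasure mdeg (polyx R ^+ i * polyy R ^+ j) = (i + j).+1.
Proof.
by have [u [<- <-] ->] := xy_mpolyX i j; rewrite mmeasureX -mdeg2.
Qed.

Lemma msize_lin (I : finType) (a : I -> R) (F : I -> bipoly R) (d : nat) :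
  (forall k, mmeasure mdeg (F k) <= d)%N ->
  (mmeasure mdeg (\sum_k a k *: F k) <= d)%N.
Proof.
move=> Fd; elim/big_ind: _ => [|f g fd gd|k _]; first by rewrite mmeasure0.
  by rewrite (leq_trans (mmeasureD_le _ _ _)) // geq_max fd.
exact: leq_trans (msizeZ_le _ _) _.
Qed.

Lemma polymon_expand (d : nat) f : (mmeasure mdeg f <= d.+1)%N ->
  f = \sum_(i < nmon d) mcoeff (mon_of i) f *: polymon R i.
Proof.
move=> fd; rewrite {1}(mpolywE fd) (reindex (@mon_of d)) //.
exact/onW_bij/enum_val_bij.
Qed.

Lemma msize_polymon (d : nat) (i : 'I_(nmon d)) :
  (mmeasure mdeg (polymon R i) <= d.+1)%N.
Proof. by rewrite /polymon mmeasureX bmdeg. Qed.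

(** The quadratic form of the matrix at the coefficient vector of [f] is the
    functional at [q * f ^+ 2]. *)
Lemma psd_rieszP (d D : nat) (gamma : tseq R D) q :
  psdmx (\matrix_(i, j < nmon d) riesz gamma (q * polymon R i * polymon R j))
  <-> forall f, (mmeasure mdeg f <= d.+1)%N -> 0 <= riesz gamma (q * f ^+ 2).
Proof.
set M := \matrix_(i, j) _.
have quad (v : 'rV_(nmon d)) : (v *m M *m v^T) 0 0 =
    riesz gamma (q * (\sum_i v 0 i *: polymon R i) ^+ 2).
  rewrite expr2 mulr_suml mulr_sumr linear_sum mxE.
  under eq_bigr => j _ do rewrite !mxE mulr_suml.
  rewrite exchange_big /=; apply: eq_bigr => i _.
  rewrite mulr_sumr mulr_sumr linear_sum; apply: eq_bigr => j _.
  have -> : q * (v 0 i *: polymon R i * (v 0 j *: polymon R j)) =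
      (v 0 i * v 0 j) *: (q * polymon R i * polymon R j).
    by rewrite -!mul_mpolyC mpolyCM; ring.
  by rewrite [RHS]linearZ /= !mxE; ring.
split=> [[_ psdM] f fd|psdf].
  have := psdM (\row_i mcoeff (mon_of i) f); rewrite quad.
  by under eq_bigr => i _ do rewrite mxE; rewrite -polymon_expand.
split=> [|v].
  by apply/matrixP => i j; rewrite !mxE mulrAC.
by rewrite quad psdf // msize_lin //; exact: msize_polymon.
Qed.

Lemma moment_mx1 (n : nat) (beta : tseq R (2 * n)) : moment_mx beta =
  \matrix_(i, j < nmon n) riesz beta (1 * polymon R i * polymon R j).
Proof. by apply/matrixP => i j; rewrite !mxE mul1r. Qed.

Lemma psd_moments_riesz (D d : nat) (gamma : tseq R D) :
  (forall f, (mmeasure mdeg f <= d.+1)%N -> 0 <= riesz gamma (1 * f ^+ 2)) ->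
  psd_moments d (fun i j => riesz gamma (polyx R ^+ i * polyy R ^+ j)).
Proof.
move=> psd I a e f ef.
have := psd (\sum_k a k *: (polyx R ^+ e k * polyy R ^+ f k)).
rewrite mul1r expr2 mulr_suml linear_sum => h; apply: le_trans (h _) _.
  by apply: msize_lin => k; rewrite msize_xy ltnS.
rewrite le_eqVlt; apply/orP; left; apply/eqP; apply: eq_bigr => k _.
rewrite mulr_sumr linear_sum; apply: eq_bigr => l _.
rewrite -scalerAl -scalerAr !linearZ /= mulrA; congr (_ * riesz _ _).
by rewrite !exprD; ring.
Qed.

Lemma split_pair (d i j : nat) : (i + j <= 2 * d)%N -> exists i1 j1 i2 j2,
  [/\ (i = i1 + i2)%N, (j = j1 + j2)%N, (i1 + j1 <= d)%N & (i2 + j2 <= d)%N].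
Proof.
move=> ij; exists (minn i d), (minn j (d - minn i d)), (i - minn i d)%N.
exists (j - minn j (d - minn i d))%N; split; lia.
Qed.

(** Both signs make the functional vanish at every q f^2; polarization then
    gives the products q f g, and every monomial of degree at most 2 d is a
    product of two monomials of degree at most d. *)
Lemma riesz_vanish (d D : nat) (gamma : tseq R D) q :
  (forall f, (mmeasure mdeg f <= d.+1)%N -> 0 <= riesz gamma (q * f ^+ 2)) ->
  (forall f, (mmeasure mdeg f <= d.+1)%N -> 0 <= riesz gamma (- q * f ^+ 2)) ->
  forall i j, (i + j <= 2 * d)%N ->
    riesz gamma (q * (polyx R ^+ i * polyy R ^+ j)) = 0.
Proof.
move=> psd psdN i j ij.
have sq0 f : (mmeasure mdeg f <= d.+1)%N -> riesz gamma (q * f ^+ 2) = 0.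
  move=> fd; apply/eqP; rewrite eq_le psd // andbT.
  by have := psdN f fd; rewrite mulNr linearN /= oppr_ge0.
have [i1 [j1 [i2 [j2 [-> -> h1 h2]]]]] := split_pair ij.
set f := polyx R ^+ i1 * polyy R ^+ j1; set g := polyx R ^+ i2 * polyy R ^+ j2.
have fd : (mmeasure mdeg f <= d.+1)%N by rewrite msize_xy.
have gd : (mmeasure mdeg g <= d.+1)%N by rewrite msize_xy.
have fgd : (mmeasure mdeg (f + g)%R <= d.+1)%N.
  by rewrite (leq_trans (mmeasureD_le _ _ _)) // geq_max fd.
have := sq0 _ fgd.
have -> : q * (f + g) ^+ 2 = q * f ^+ 2 + q * g ^+ 2 +
    (q * (f * g) + q * (f * g)) by ring.
rewrite !linearD /= !sq0 // !add0r -mulr2n => /eqP.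
rewrite mulrn_eq0 /= => /eqP h; rewrite -[RHS]h; congr (riesz _ (_ * _)).
by rewrite /f /g !exprD; ring.
Qed.

Lemma peval_expand (d : nat) f (z : R * R) : (mmeasure mdeg f <= d)%N ->
  peval f z = \sum_(u : bmultinom 2 d)
    mcoeff u f * (z.1 ^+ (u : multinom 2) ord0 * z.2 ^+ (u : multinom 2) ord_max).
Proof.
move=> fd; rewrite {1}(mpolywE fd) /peval raddf_sum; apply: eq_bigr => u _ /=.
by rewrite mevalZ mpolyX_xy rmorphM !rmorphXn /= /polyx /polyy !mevalXU.
Qed.

Lemma riesz_atomic (d : nat) (gamma : tseq R d) (atoms : seq (R * (R * R))) :
  (forall u, gamma u =
     \sum_(a <- atoms) a.1 * (a.2.1 ^+ u ord0 * a.2.2 ^+ u ord_max)) ->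
  forall f, (mmeasure mdeg f <= d.+1)%N ->
    riesz gamma f = \sum_(a <- atoms) a.1 * peval f a.2.
Proof.
move=> gammaE f fd; rewrite /riesz.
under [RHS]eq_bigr => a _ do rewrite (peval_expand _ fd) mulr_sumr.
rewrite exchange_big; apply: eq_bigr => u _ /=.
by rewrite gammaE mulr_sumr; apply: eq_bigr => a _; rewrite mulrCA.
Qed.
End Riesz.

(** * Extensions and atomic moments *)

Section Extensions.
Variable R : realType.

Lemma polymon_xy (d i j : nat) : (i + j <= d)%N ->
  exists k : 'I_(nmon d), polymon R k = polyx R ^+ i * polyy R ^+ j.
Proof.
move=> ij; have [u [ui uj] ->] := xy_mpolyX R i j.
have ud : (mdeg u < d.+1)%N by rewrite mdeg2 ui uj ltnS.
by exists (enum_rank (BMultinom ud)); rewrite /polymon /mon_of enum_rankK.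
Qed.

Lemma polymon_widen (d e : nat) (le_de : (d <= e)%N) (i : 'I_(nmon d)) :
  polymon R (widen_idx le_de i) = polymon R i.
Proof. by rewrite /polymon /widen_idx /mon_of enum_rankK. Qed.

Lemma positive_extension_moments (n k : nat) (beta : tseq R (2 * n))
    (gamma : tseq R (2 * (n + k))) : positive_extension beta gamma ->
  forall i j, (i + j <= 2 * n)%N ->
    riesz gamma (polyx R ^+ i * polyy R ^+ j) =
    riesz beta (polyx R ^+ i * polyy R ^+ j).
Proof.
move=> [_ /matrixP ext] i j ij.
have [i1 [j1 [i2 [j2 [-> -> h1 h2]]]]] := split_pair ij.
have [k1 e1] := polymon_xy h1; have [k2 e2] := polymon_xy h2.
have := ext k1 k2; rewrite !mxE !polymon_widen e1 e2.
have -> : polyx R ^+ i1 * polyy R ^+ j1 * (polyx R ^+ i2 * polyy R ^+ j2) =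
          polyx R ^+ (i1 + i2) * polyy R ^+ (j1 + j2) by rewrite !exprD; ring.
by [].
Qed.

Variables (l1 l2 : nat) (q : bipoly R) (n : nat).
Hypothesis q_xy : q = polyx R \/ q = polyy R.
Let s := (l1 + l2)%N.
Let p := q * (polyx R ^+ l1 * polyy R ^+ l2 - 1).

Lemma msize_p : (mmeasure mdeg p <= s.+2)%N.
Proof.
suff [i [j [i' [j' [-> h h']]]]] : exists i j i' j',
    [/\ p = polyx R ^+ i * polyy R ^+ j - polyx R ^+ i' * polyy R ^+ j',
        (i + j <= s.+1)%N & (i' + j' <= s.+1)%N].
  by rewrite (leq_trans (mmeasureD_le _ _ _)) // mmeasureN !msize_xy geq_max !ltnS h.
case: q_xy => qE; [exists l1.+1, l2, 1%N, 0%N|exists l1, l2.+1, 0%N, 1%N];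
  by rewrite /p qE !exprS ?expr0 /s; split; [ring|lia|lia].
Qed.

Lemma peval_p (x y : R) :
  peval p (x, y) = peval q (x, y) * (x ^+ l1 * y ^+ l2 - 1).
Proof.
rewrite /p /peval rmorphM rmorphB rmorphM !rmorphXn rmorph1 /=.
by rewrite /polyx /polyy !mevalXU.
Qed.

Lemma peval_px (x y : R) : q = polyx R ->
  peval p (x, y) = x * (x ^+ l1 * y ^+ l2 - 1).
Proof. by move=> qE; rewrite peval_p qE /peval /polyx mevalXU. Qed.

Lemma peval_py (x y : R) : q = polyy R ->
  peval p (x, y) = y * (y ^+ l2 * x ^+ l1 - 1).
Proof.
by move=> qE; rewrite peval_p qE /peval /polyy mevalXU [in RHS](mulrC (y ^+ l2)).
Qed.

Lemma atomic_peval (m : nat) (G : nat -> nat -> R) :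
  (q = polyx R -> atomic_moments (line_or_curve l1 l2) m G) ->
  (q = polyy R -> atomic_moments (line_or_curve l2 l1) m (fun i j => G j i)) ->
  atomic_moments (fun x y => peval p (x, y) = 0) m G.
Proof.
move=> atx aty; case: q_xy => qE.
  have [atoms atP atE] := atx qE; exists atoms => // a /atP [? h].
  by rewrite peval_px.
have [atoms atP atE] := aty qE.
exists [seq (a.1, (a.2.2, a.2.1)) | a <- atoms].
  move=> b /mapP [a /atP [? h] ->].
  by rewrite peval_py.
move=> i j ij; rewrite big_map /= (atE j i) 1?addnC //.
by apply: eq_bigr => a _; rewrite [X in _ * X]mulrC.
Qed.

(** The extension consists of the moments of the same atoms in higher degree;
    its localizing matrices vanish because p does at the atoms. *)
Lemma extension_of_atomic (beta : tseq R (2 * n)) :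
  (s + 1 <= n)%N ->
  atomic_moments (fun x y => peval p (x, y) = 0) n.*2
    (fun i j => riesz beta (polyx R ^+ i * polyy R ^+ j)) ->
  exists gamma : tseq R (2 * (n + 2 * s)), positive_extension beta gamma /\
    psdmx (localizing_mx gamma p) /\ psdmx (localizing_mx gamma (- p)).
Proof.
move=> n_ge [atoms atP atE].
pose mom d : tseq R d := fun u =>
  \sum_(a <- atoms) a.1 * (a.2.1 ^+ (u : multinom 2) ord0 *
                            a.2.2 ^+ (u : multinom 2) ord_max).
have beta_mom : beta = mom (2 * n)%N.
  apply: funext => u; rewrite -(riesz_mon beta u) mpolyX_xy atE // -mdeg2.
  by rewrite -mul2n -ltnS bmdeg.
have momE d := @riesz_atomic R d (mom d) atoms (fun u => erefl).
pose gamma := mom (2 * (n + 2 * s))%N; exists gamma.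
have sizeM (f g : bipoly R) :
    (mmeasure mdeg (f * g)%R <= mmeasure mdeg f + mmeasure mdeg g - 1)%N.
  have [->|f0] := eqVneq f 0; first by rewrite mul0r mmeasure0.
  have [->|g0] := eqVneq g 0; first by rewrite mulr0 mmeasure0.
  by rewrite msizeM // subn1.
have loc (r : bipoly R) : (mmeasure mdeg r <= s.+2)%N ->
    (forall a, a \in atoms -> 0 <= peval r a.2) ->
    forall f, (mmeasure mdeg f <= (n + 2 * s - uphalf (pdeg r)).+1)%N ->
      0 <= riesz gamma (r * f ^+ 2).
  move=> sr r0 f sf; rewrite momE; last first.
    rewrite (leq_trans (sizeM _ _)) //.
    have := sizeM f f; rewrite -expr2; move: sf sr; rewrite /pdeg; move: n_ge; lia.
  rewrite big_seq sumr_ge0 // => a ain; have [a0 _] := atP a ain.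
  by rewrite mulr_ge0 // /peval rmorphM rmorphXn /= mulr_ge0 ?r0 ?sqr_ge0.
split; [split|split].
- rewrite moment_mx1; apply/psd_rieszP => f sf; apply: loc => //.
  + by rewrite mmeasure1.
  + by move=> a _; rewrite /peval rmorph1.
  + by rewrite /pdeg mmeasure1 subn0.
- apply/matrixP => i j; rewrite !mxE !polymon_widen beta_mom !momE //.
  + rewrite (leq_trans (sizeM _ _)) //.
    by have := msize_polymon R i; have := msize_polymon R j; lia.
  + rewrite (leq_trans (sizeM _ _)) //.
    by have := msize_polymon R i; have := msize_polymon R j; lia.
- apply/psd_rieszP; apply: loc; first exact: msize_p.
  by move=> a /atP [_]; rewrite -surjective_pairing => ->.
- apply/psd_rieszP; apply: loc; first by rewrite mmeasureN msize_p.
  move=> a /atP [_]; rewrite -surjective_pairing /peval rmorphN /= => ->.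
  by rewrite oppr0.
Qed.
Hypotheses (l1_gt1 : (1 < l1)%N) (l2_gt1 : (1 < l2)%N) (col12 : coprime l1 l2).

(** For q = y the coordinates are exchanged, together with the two exponents. *)
Lemma atomic_of_extension (beta : tseq R (2 * n))
    (gamma : tseq R (2 * (n + 2 * s))) :
  positive_extension beta gamma ->
  psdmx (localizing_mx gamma p) -> psdmx (localizing_mx gamma (- p)) ->
  atomic_moments (fun x y => peval p (x, y) = 0) n.*2
    (fun i j => riesz beta (polyx R ^+ i * polyy R ^+ j)).
Proof.
move=> ext /psd_rieszP psdp /psd_rieszP psdNp.
have pdegN : pdeg (- p) = pdeg p by rewrite /pdeg mmeasureN.
rewrite pdegN in psdNp; set d := (_ - _)%N in psdp psdNp.
have d_ge : (2 * n + 3 * s - 2 <= 2 * d)%N.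
  by rewrite /d /pdeg; have := msize_p; lia.
have van := riesz_vanish psdp psdNp.
pose G i j := riesz gamma (polyx R ^+ i * polyy R ^+ j).
have psdG : psd_moments (n + 2 * s) G.
  apply: psd_moments_riesz; apply/psd_rieszP; rewrite -moment_mx1.
  by case: ext.
suff [atoms atP atE] : atomic_moments (fun x y => peval p (x, y) = 0) n.*2 G.
  exists atoms => // i j ij.
  by rewrite -(positive_extension_moments ext) ?mul2n // -/(G i j) atE.
apply: atomic_peval => qE.
  apply: atomic_of_psd => // i j ij; apply/eqP; rewrite -subr_eq0 -linearB /=.
  apply/eqP; rewrite -[RHS](van i j) ?(leq_trans ij) // /p qE.
  by congr (riesz _ _); rewrite !exprD !exprS; ring.
apply: atomic_of_psd => //; last by rewrite coprime_sym.
  move=> I a e f ef; apply: psdG => k; rewrite addnC (leq_trans (ef k)) //.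
  by rewrite (addnC l2).
move=> i j ij; apply/eqP; rewrite -subr_eq0 -linearB /=; apply/eqP.
rewrite -[RHS](van j i); last by rewrite addnC (leq_trans ij) // (addnC l2).
by rewrite /p qE; congr (riesz _ _); rewrite !exprD !exprS; ring.
Qed.

End Extensions.

(** * Measures and atomic moments *)

Section AtomsToMeasure.
Variable R : realType.
Local Open Scope classical_set_scope.
Local Open Scope ereal_scope.

Lemma atoms_measure (d : measure_display) (T : measurableType d)
    (atoms : seq (R * T)) : (forall a, a \in atoms -> (0 <= a.1)%R) ->
  exists mu : {measure set T -> \bar R},
    (forall S : set T, (forall a, a \in atoms -> ~ S a.2) -> mu S = 0) /\
    forall f : T -> R, measurable_fun [set: T] f ->
      mu.-integrable [set: T] (EFin \o f) /\
      \int[mu]_z (f z)%:E = (\sum_(a <- atoms) a.1 * f a.2)%R%:E.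
Proof.
elim: atoms => [|[w z] atoms IH] w0.
  exists mzero; split=> // f mf; rewrite big_nil integral_measure_zero; split=> //.
  apply/integrableP; split; first exact/measurable_EFinP.
  by rewrite integral_measure_zero.
have [|mu [muS muf]] := IH; first by move=> a ain; apply: w0; rewrite inE ain orbT.
have w_ge0 : (0 <= w)%R by have := w0 (w, z); rewrite inE eqxx; apply.
pose nu : {measure set T -> \bar R} := mscale (NngNum w_ge0) (dirac z).
have nuE (f : T -> \bar R) : measurable_fun [set: T] f -> (forall x, 0 <= f x) ->
    \int[nu]_x f x = w%:E * f z.
  move=> mf f0; rewrite ge0_integral_mscale // integral_dirac //= diracT mul1e.
  by [].
have nuf (f : T -> R) : measurable_fun [set: T] f ->
    nu.-integrable [set: T] (EFin \o f) /\ \int[nu]_x (f x)%:E = (w * f z)%:E.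
  move=> mf; have mEf : measurable_fun [set: T] (EFin \o f) by exact/measurable_EFinP.
  split.
    apply/integrableP; split => //; rewrite nuE ?ltry //.
    exact: measurableT_comp.
  rewrite integralE !nuE //.
  - rewrite funeposE funenegE /= -!EFin_max -!EFinM -EFinB -mulrBr.
    congr (_ * _)%:E; rewrite /Num.max; case: ltP => ?; case: ltP => ?; lra.
  - exact: measurable_funeneg.
  - exact: measurable_funepos.
exists (measure_add nu mu); split=> [S Sat|f mf].
  rewrite [LHS]measure_addE muS ?adde0; last first.
    by move=> a ain; apply: Sat; rewrite inE ain orbT.
  rewrite /nu /= /mscale /= diracE memNset ?mule0 //.
  by apply: (Sat (w, z)); rewrite inE eqxx.
have mEf : measurable_fun [set: T] (EFin \o f) by exact/measurable_EFinP.
have [inu enu] := nuf f mf; have [imu emu] := muf f mf; split.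
  apply/integrableP; split => //; rewrite ge0_integral_measure_add //.
    have [_ h1] := integrableP _ _ _ inu; have [_ h2] := integrableP _ _ _ imu.
    exact: lte_add_pinfty.
  exact: measurableT_comp.
by rewrite integral_measure_add // enu emu big_cons EFinD.
Qed.
End AtomsToMeasure.

Section MeasureToAtoms.
Variables (R : realType) (d : measure_display) (T : measurableType d).
Variable mu : {measure set T -> \bar R}.
Local Open Scope classical_set_scope.
Local Open Scope ring_scope.

(** If the functional kills g^2 then g (t x) vanishes wherever the density [W] is
    nonzero, almost everywhere, and so do all multiples of g; if [t] avoids 0 the
    same holds for the factor g of 'X * g. *)
Lemma measure_hamburger (E : set T) (t W : T -> R) (D : nat) (b : bool) :
  measurable E -> (forall x, E x -> 0 <= W x) ->
  (b -> forall x, E x -> t x != 0) ->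
  (forall m, (m <= D.*2)%N ->
     mu.-integrable E (EFin \o (fun x => t x ^+ m * W x))) ->
  exists2 atoms : seq (R * R),
    forall a, a \in atoms -> 0 <= a.1 /\ (b -> a.2 != 0) &
    forall m, (m <= D.*2)%N ->
      \int[mu]_(x in E) (t x ^+ m * W x) = \sum_(a <- atoms) a.1 * a.2 ^+ m.
Proof.
move=> mE W0 t0 int.
pose c m := \int[mu]_(x in E) (t x ^+ m * W x).
have hk (f : {poly R}) : (size f <= D.*2.+1)%N ->
    mu.-integrable E (EFin \o (fun x => f.[t x] * W x)) /\
    riesz1 c f = \int[mu]_(x in E) (f.[t x] * W x).
  move=> sf; rewrite (polyXn_expand sf).
  elim/big_ind: _ => [|f1 f2 [i1 e1] [i2 e2]|i _].
  - split; last first.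
      rewrite linear0 (@eq_Rintegral _ _ _ mu E (cst 0)) ?Rintegral_cst ?mul0r //.
      by move=> x _; rewrite horner0 mul0r.
    apply: (eq_integrable mE (cst 0%E)) (integrable0 _ _) => x _.
    by rewrite /= horner0 mul0r.
  - have e x : (f1 + f2).[t x] * W x = f1.[t x] * W x + f2.[t x] * W x.
      by rewrite hornerD mulrDl.
    split.
      apply: (eq_integrable mE _ _ _ (integrableD mE i1 i2)) => x _ /=.
      by rewrite e.
    rewrite linearD /= e1 e2 -RintegralD //; apply: eq_Rintegral => x _.
    by rewrite e.
  - have e x : (f`_i *: 'X^i).[t x] * W x = f`_i * (t x ^+ i * W x).
      by rewrite hornerZ hornerXn mulrA.
    have ii := int i (ltn_ord i); split.
      apply: (eq_integrable mE _ _ _ (integrableZl mE f`_i ii)) => x _ /=.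
      by rewrite e.
    rewrite linearZ /= riesz1Xn /c -RintegralZl //; apply: eq_Rintegral => x _.
    by rewrite e.
have ssq (g : {poly R}) : (size g <= D.+1)%N -> (size (g ^+ 2)%R <= D.*2.+1)%N.
  move=> sg; rewrite expr2 (leq_trans (size_polyMleq _ _)) //.
  by have := leq_add sg sg; rewrite -addnn; lia.
have null (g f : {poly R}) : (size g <= D.+1)%N -> (size f <= D.*2.+1)%N ->
    (forall x, E x -> g.[t x] = 0 -> f.[t x] = 0) ->
    riesz1 c (g ^+ 2) = 0 -> riesz1 c f = 0.
  move=> sg sf gf; have [ig eg] := hk _ (ssq _ sg); have [i_f ef] := hk _ sf.
  rewrite eg ef => g0.
  have : ae_eq mu E (EFin \o (fun x => (g ^+ 2).[t x] * W x)) (cst 0%E).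
    apply/ae_eq_integral_abs => //; first exact: measurable_int ig.
    under eq_integral => x xE.
      rewrite /= ger0_norm; last first.
        by rewrite horner_exp mulr_ge0 ?sqr_ge0 // W0 //; exact: set_mem.
      over.
    by rewrite -[LHS]fineK ?(integrable_fin_num mE ig) // -/(Rintegral _ _ _) g0.
  move=> ae0; rewrite /Rintegral (ae_eq_integral (cst 0%E)) ?integral0 //.
    exact: measurable_int i_f.
  apply: filterS ae0 => x + Ex; move=> /(_ Ex) /= [].
  move/eqP; rewrite mulf_eq0 horner_exp sqrf_eq0 => /orP [/eqP g00|/eqP ->].
    by rewrite gf // mul0r.
  by rewrite mulr0.
apply: truncated_hamburger => [g sg|g h sg g0 sgh|bT g sg].
- have [_ ->] := hk _ (ssq _ sg); apply: Rintegral_ge0 => x Ex.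
  by rewrite horner_exp mulr_ge0 ?sqr_ge0 ?W0.
- by apply: null g0 => // x _; rewrite hornerM => ->; rewrite mul0r.
- apply: null => [||x Ex].
  + by rewrite (leq_trans (size_polyMleq _ _)) // size_polyX.
  + by rewrite ssq // ltnW.
  + rewrite hornerM hornerX => /eqP; rewrite mulf_eq0 (negPf (t0 bT x Ex)) /=.
    by move=> /eqP g0; rewrite horner_exp g0 expr0n.
Qed.
End MeasureToAtoms.

Section MeasureOnLineAndCurve.
Variables (R : realType) (d : measure_display) (T : measurableType d).
Variables (mu : {measure set T -> \bar R}) (X Y : T -> R) (l1 l2 n : nat).
Local Open Scope classical_set_scope.
Local Open Scope ring_scope.
Hypotheses (mX : measurable_fun [set: T] X) (mY : measurable_fun [set: T] Y).
Hypotheses (l1_gt0 : (0 < l1)%N) (l2_gt0 : (0 < l2)%N) (col12 : coprime l1 l2).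
Let E1 := [set x | X x = 0].
Let E2 := [set x | X x ^+ l1 * Y x ^+ l2 = 1].
Hypothesis supp : mu (~` (E1 `|` E2)) = 0%E.
Hypothesis int : forall i j, (i + j <= n.*2)%N ->
  mu.-integrable [set: T] (EFin \o (fun x => X x ^+ i * Y x ^+ j)).

(** On the curve the density Y^(2n) is t^(- 2 n l1), so that the exponents
    0, ..., 2 D of t stand for - 2 n l1, ..., 2 n l2. All these moments exist,
    even those not given by a monomial of degree at most 2n, because |t|^m is at
    most the sum of its values for the two extreme exponents, which are Y^(2n)
    and X^(2n). *)
Lemma measure_atomic : atomic_moments (line_or_curve l1 l2) n.*2
  (fun i j => \int[mu]_x (X x ^+ i * Y x ^+ j)).
Proof.
have mlevel (f : T -> R) (r : R) : measurable_fun [set: T] f ->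
    measurable [set x | f x = r].
  by move=> mf; have := mf measurableT _ (measurable_set1 r); rewrite setTI.
have mmon i j : measurable_fun [set: T] (fun x => X x ^+ i * Y x ^+ j).
  by apply: measurable_funM; exact: measurable_funX.
have mE1 : measurable E1 by exact: mlevel.
have mE2 : measurable E2 by exact: mlevel.
have intS i j (E : set T) : measurable E -> (i + j <= n.*2)%N ->
    mu.-integrable E (EFin \o (fun x => X x ^+ i * Y x ^+ j)).
  by move=> mE ij; apply: integrableS (int ij).
have XE2 x : E2 x -> X x != 0.
  rewrite /E2 /=; apply: contra_eqN => /eqP ->.
  by rewrite expr0n (gtn_eqF l1_gt0) mul0r eq_sym oner_eq0.
(* With u * l2 = v * l1 + 1, tau recovers t at the point (t ^+ l2, t ^- l1) of
   the curve, without dividing. *)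
have [u v uv _] := egcdnP l1 l2_gt0; rewrite gcdnC (eqP col12) in uv.
pose tau x := X x ^+ u * Y x ^+ v.
have tauX x : E2 x -> tau x ^+ l2 = X x.
  rewrite /E2 /= => e; rewrite /tau exprMn -!exprM uv addn1 exprS.
  by rewrite -mulrA mulnC [(v * l2)%N]mulnC !exprM -exprMn e expr1n mulr1.
have tauY x : E2 x -> tau x ^+ l1 * Y x = 1.
  rewrite /E2 /= => e; rewrite /tau exprMn -!exprM -mulrA -exprSr -addn1 -uv.
  by rewrite [(u * l1)%N]mulnC [(u * l2)%N]mulnC !exprM -exprMn e expr1n.
have tau0 x : E2 x -> tau x != 0.
  move=> Ex; apply: contraNneq (XE2 x Ex) => t0.
  by rewrite -tauX // t0 expr0n (gtn_eqF l2_gt0).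
have [|||atl atlP atlE] := @measure_hamburger R d T mu E1 Y (cst 1) n false mE1.
- by move=> x _; exact: ler01.
- by [].
- move=> m mn; apply: eq_integrable (intS 0%N m E1 mE1 mn) => // x _ /=.
  by rewrite mul1r mulr1.
pose D := (n * l1 + n * l2)%N.
have tauW m x : E2 x -> (m <= D.*2)%N ->
    `|tau x ^+ m * Y x ^+ n.*2| <= Y x ^+ n.*2 + X x ^+ n.*2.
  move=> Ex mD; have ev (y : R) : 0 <= y ^+ n.*2 by rewrite -muln2 exprM sqr_ge0.
  rewrite normrM normrX (ger0_norm (ev _)).
  have [t1|t1] := leP `|tau x| 1.
    by rewrite -[leLHS]addr0 lerD // ler_piMl // exprn_ile1.
  rewrite -[leLHS]add0r lerD //.
  have -> : X x ^+ n.*2 = `|tau x| ^+ D.*2 * Y x ^+ n.*2.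
    rewrite -normrX ger0_norm; last by rewrite -muln2 exprM sqr_ge0.
    rewrite doubleD exprD !doubleMl [(n.*2 * l1)%N]mulnC [(n.*2 * l2)%N]mulnC.
    by rewrite !exprM tauX // mulrAC -exprMn tauY // expr1n mul1r.
  by rewrite ler_wpM2r // ler_weXn2l // ltW.
have [|||atc atcP atcE] := @measure_hamburger R d T mu E2 tau
    (fun x => Y x ^+ n.*2) D true mE2.
- by move=> x _; rewrite -muln2 exprM sqr_ge0.
- by move=> _; exact: tau0.
- move=> m mD.
  have i0 : mu.-integrable E2 (EFin \o (fun x => Y x ^+ n.*2 + X x ^+ n.*2)).
    have := integrableD mE2 (intS 0%N n.*2 E2 mE2 (leqnn _)) (intS n.*2 0%N E2 mE2 _).
    rewrite addn0 leqnn => /(_ isT); apply: eq_integrable => // x _ /=.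
    by rewrite !expr0 mul1r mulr1.
  apply: le_integrable i0 => //.
    apply/measurable_EFinP/measurable_funTS/measurable_funM; last first.
      exact: measurable_funX.
    exact/measurable_funX/mmon.
  by move=> x Ex /=; rewrite lee_fin (le_trans (tauW m x Ex mD)) // ler_norm.
apply: (assemble_atoms l1_gt0 _ _ atlE atcE).
- by move=> a /atlP [].
- by move=> a /atcP [? /(_ isT)].
move=> i j ij.
have disj : [disjoint E1 & E2].
  by apply/disj_setPS => x [] /= X0 /XE2; rewrite X0 eqxx.
have mU : measurable (E1 `|` E2) by exact: measurableU.
have -> : \int[mu]_x (X x ^+ i * Y x ^+ j) =
    \int[mu]_(x in E1 `|` E2) (X x ^+ i * Y x ^+ j).
  rewrite /Rintegral (negligible_integral (measurableC mU) measurableT (int ij) supp).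
  by rewrite setDE setTI setCK.
rewrite Rintegral_setU //; last exact: intS.
congr (_ + _).
  have [->|i0] := eqVneq i 0%N.
    by rewrite mul1r; apply: eq_Rintegral => x _; rewrite mul1r mulr1.
  rewrite mul0r (@eq_Rintegral _ _ _ mu E1 (cst 0)) ?Rintegral_cst ?mul0r //.
  by move=> x /set_mem; rewrite /E1 /= => ->; rewrite expr0n (negPf i0) mul0r.
apply: eq_Rintegral => x /set_mem Ex.
have jn : (j <= n.*2)%N by rewrite (leq_trans _ ij) // leq_addl.
have -> : ((n * l1).*2 + l2 * i - l1 * j = l2 * i + l1 * (n.*2 - j))%N.
  rewrite mulnBr doubleMl [(n.*2 * l1)%N]mulnC addnC addnBA // leq_mul2l.
  by rewrite jn orbT.
rewrite exprD !exprM tauX // -mulrA; congr (_ * _).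
by rewrite -{2}(subnK jn) exprD mulrA -exprMn tauY // expr1n mul1r.
Qed.
End MeasureOnLineAndCurve.

(** * Property S for the line and the curve *)

Theorem theorem4p3 (R : realType) (l1 l2 : nat) (q : bipoly R) (n : nat) :
  (1 < l1)%N -> (1 < l2)%N -> gcdn l1 l2 = 1%N ->
  q = polyx R \/ q = polyy R ->
  (l1 + l2 + 1 <= n)%N ->
  let p := q * (polyx R ^+ l1 * polyy R ^+ l2 - 1) in
  property_S [:: 1; p; - p] n (2 * (l1 + l2)).
Proof.
move=> l1_gt1 l2_gt1 gcd1 q_xy n_ge p beta.
have col12 : coprime l1 l2 by rewrite /coprime gcd1.
have KE : semialg_set [:: 1; p; - p] = [set z | peval p z = 0]%classic.
  apply/seteqP; split=> z /= h.
    apply/eqP; rewrite eq_le (h 1%N isT) andbT.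
    by have := h 2%N isT; rewrite /= /peval rmorphN oppr_ge0.
  case=> [|[|[|//]]] _ /=; first by rewrite /peval rmorph1.
    by rewrite h.
  by rewrite /peval rmorphN /= -/(peval _ _) h oppr0.
split=> [[mu [mu0 muE]]|[gamma [ext loc]]]; last first.
  have [atoms atP atE] := atomic_of_extension q_xy l1_gt1 l2_gt1 col12 ext
    (loc 1%N isT) (loc 2%N isT).
  have [|mu [mu0 muE]] := @atoms_measure R _ (plane R) atoms.
    by move=> a /atP [].
  exists mu; split.
    by apply: mu0 => a /atP [_ h]; apply; rewrite KE /= -surjective_pairing in h *.
  move=> u xy.
  have mxy : measurable_fun [set: plane R]%classic xy.
    apply: measurable_funM; apply: measurable_funX.
      exact: measurable_fst.
    exact: measurable_snd.
  have [ixy exy] := muE xy mxy; split=> //.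
  rewrite exy -(riesz_mon beta u) mpolyX_xy atE //.
  by rewrite -mdeg2 -mul2n -ltnS bmdeg.
have muG i j : (i + j <= n.*2)%N ->
    mu.-integrable [set: plane R]%classic
      (EFin \o (fun z : plane R => (z.1 : R) ^+ i * (z.2 : R) ^+ j)) /\
    riesz beta (polyx R ^+ i * polyy R ^+ j) =
    \int[mu]_z ((z.1 : R) ^+ i * (z.2 : R) ^+ j).
  have [u [<- <-] ->] := xy_mpolyX R i j; rewrite -mdeg2 -mul2n => ij.
  have ud : (mdeg u < (2 * n).+1)%N by rewrite ltnS.
  have [iu eu] := muE (BMultinom ud); split; first exact: iu.
  by rewrite (riesz_mon beta (BMultinom ud)) /Rintegral eu.
have at_p : atomic_moments (fun x y => peval p (x, y) = 0) n.*2
    (fun i j => riesz beta (polyx R ^+ i * polyy R ^+ j)).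
  have eq0P (a b : R) : a * (b - 1) = 0 <-> a = 0 \/ b = 1.
    split=> [/eqP|[->|->]]; rewrite ?mul0r ?subrr ?mulr0 //.
    by rewrite mulf_eq0 subr_eq0 => /orP [/eqP|/eqP]; [left|right].
  apply: (atomic_peval q_xy) => qE.
    have [|i j ij|atoms atP atE] := @measure_atomic R _ _ mu
        (fun z : plane R => z.1 : R) (fun z : plane R => z.2 : R) l1 l2 n
        measurable_fst measurable_snd (ltnW l1_gt1) (ltnW l2_gt1) col12.
    - rewrite -[RHS]mu0 KE; congr (mu (~` _)%classic).
      by apply/seteqP; split=> -[x y] /=; rewrite (peval_px _ _ _ _ qE) => /eq0P.
    - by case: (muG i j ij).
    by exists atoms => // i j ij; have [_ ->] := muG i j ij; rewrite atE.
  have swap i j : (fun z : plane R => (z.2 : R) ^+ i * (z.1 : R) ^+ j) =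
      (fun z => (z.1 : R) ^+ j * (z.2 : R) ^+ i).
    by apply/funext => z; rewrite mulrC.
  have [||i j ij|atoms atP atE] := @measure_atomic R _ _ mu
      (fun z : plane R => z.2 : R) (fun z : plane R => z.1 : R) l2 l1 n
      measurable_snd measurable_fst (ltnW l2_gt1) (ltnW l1_gt1) _.
  - by rewrite coprime_sym.
  - rewrite -[RHS]mu0 KE; congr (mu (~` _)%classic).
    by apply/seteqP; split=> -[x y] /=; rewrite (peval_py _ _ _ _ qE) => /eq0P.
  - by rewrite swap; have [] := muG j i; rewrite 1?addnC.
  exists atoms => // i j ij; have [|_ ->] := muG j i; first by rewrite addnC.
  by rewrite -atE // swap.
have [gamma [ext [loc1 loc2]]] :=
  extension_of_atomic q_xy n_ge at_p.
by exists gamma; split=> // -[|[|[|//]]].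
Qed.
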